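(* Let $(\lambda^{(N)},m^{(N)})$ be a sequence where $\lambda$ is a partition with $\ell(\lambda)\le m$, written (with $m$ parts, including zero parts) in exponential notation $\lambda=\ell_1^{e_1}\cdots\ell_k^{e_k}$ with $\ell_1>\ell_2>\cdots>\ell_k\ge0$, each $e_i>0$, and $e_1+\cdots+e_k=m$. Then for each fixed even $d\ge2$, $$\kappa_d^{\lambda;m}=\Theta\Big(\sum_{1\le a<b\le k}(\ell_a-\ell_b)\,e_ae_b\,(\ell_a-\ell_b-1+e_a+\cdots+e_b)^{d-1}\Big).$$ Furthermore, $\mathcal X_{\lambda;m}[\mathrm{rank}]$ is asymptotically normal if $$\mathrm{weft}(\lambda)=\frac{\sum_{1\le a<b\le k}(\ell_a-\ell_b)e_ae_b(\ell_a-\ell_b-1+e_a+\cdots+e_b)}{(\ell_1-\ell_k-1+m)^2}\to\infty.$$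
   Context: Exponential notation $\ell_1^{e_1}\cdots\ell_k^{e_k}$ means the partition has exactly $e_i$ parts equal to $\ell_i$ (parts equal to $0$ allowed, so the total number of parts is $m$). $\mathrm{SSYT}_{\le m}(\lambda)$ is the set of semistandard tableaux of shape $\lambda$ with entries in $\{1,\dots,m\}$; $\mathrm{rank}(T)=\sum_i(i-1)\alpha_i$ with $\alpha_i$ the number of entries equal to $i$. $\mathcal X_{\lambda;m}[\mathrm{rank}]$ is $\mathrm{rank}(T)$ for uniform $T\in\mathrm{SSYT}_{\le m}(\lambda)$, $\kappa_d^{\lambda;m}$ its $d$-th cumulant. $f=\Theta(g)$ means $ag\le f\le bg$ for constants $a,b>0$ for all sufficiently large $N$. Asymptotically normal means the standardizations $(\mathcal X-\mu)/\sigma$ converge in distribution to $\mathcal N(0,1)$.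
   Formalization: The Θ estimate is stated for the absolute value |κ_d| instead of κ_d, because κ_d is negative when 4 divides d (for λ=(1), m=2, κ_4=−1/8 while the sum is 8); the sign of κ_d is not asserted for the other even d. *)

(* Defs.v *)
From mathcomp Require Import all_boot all_order all_algebra.
From mathcomp Require Import all_classical all_reals all_analysis.

Set Implicit Arguments.
Unset Strict Implicit.
Unset Printing Implicit Defensive.

Import Order.TTheory GRing.Theory Num.Theory.
Import numFieldNormedType.Exports.

Local Open Scope classical_set_scope.
Local Open Scope ring_scope.

(* Partitions are lists of positive parts, so that [size] is the length. *)
Definition is_partition (lam : seq nat) : bool :=
  sorted geq lam && (0 \notin lam)%N.

(* [lam], padded with zeros to [m] parts, equals l_1^{e_1} ... l_k^{e_k} with
   l_1 > ... > l_k >= 0, all e_i > 0 and e_1 + ... + e_k = m, where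
   [l = [:: l_1; ...; l_k]] and [e = [:: e_1; ...; e_k]]. *)
Definition exp_notation (lam : seq nat) (m : nat) (l e : seq nat) : Prop :=
  [/\ size l = size e,
      sorted gtn l,
      all (leq 1) e,
      sumn e = m
    & lam ++ nseq (m - size lam) 0%N =
      flatten [seq nseq p.2 p.1 | p <- zip l e]].

Section Tableaux.
Variables (lam : seq nat) (m : nat).

Definition cell : finType := {i : 'I_(size lam) & 'I_(nth 0%N lam i)}.
Definition row_of (c : cell) : nat := tag c.
Definition col_of (c : cell) : nat := tagged c.

(* The entries 1, ..., m are represented by the ordinals 0, ..., m - 1. *)
Definition filling : finType := {ffun cell -> 'I_m}.

Definition is_ssyt (T : filling) : bool :=
  [forall c : cell, forall c' : cell,
     ((row_of c == row_of c') && (col_of c < col_of c')%N ==> (T c <= T c')%N)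
  && ((col_of c == col_of c') && (row_of c < row_of c')%N ==> (T c < T c')%N)].

Definition ssyt : finType := {T : filling | is_ssyt T}.

(* Because of the shift of the entries, the factor i - 1 becomes i. *)
Definition rank (T : ssyt) : nat :=
  (\sum_(i < m) i * #|[pred c : cell | val T c == i]|)%N.

End Tableaux.

Section UniformVariables.
Variables (R : realType) (Omega : finType).
Implicit Type X : Omega -> R.

Definition uexp X : R := (\sum_w X w) / #|Omega|%:R.

Definition uvar X : R := uexp (fun w => (X w - uexp X) ^+ 2).

Definition ustd X : Omega -> R := fun w => (X w - uexp X) / Num.sqrt (uvar X).

Definition ucdf X (t : R) : R := #|[pred w | X w <= t]|%:R / #|Omega|%:R.

Definition umgf X (t : R) : R := uexp (fun w => expR (t * X w)).

Definition ucumulant (d : nat) X : R :=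
  derive1n d (fun t : R => ln (umgf X t)) 0.

End UniformVariables.

Definition asymp_normal (R : realType) (Omega : nat -> finType)
    (X : forall N, Omega N -> R) : Prop :=
  forall t : R,
    (ucdf (ustd (X N)) t)%:E @[N --> \oo]
      --> normal_prob (0 : R) (1 : R) [set x : R | x <= t].

Definition Theta (R : realType) (f g : nat -> R) : Prop :=
  exists a b : R, [/\ 0 < a, 0 < b &
    \forall N \near \oo, a * g N <= f N <= b * g N].

Definition rank_var (R : realType) (lam : seq nat) (m : nat) :
    ssyt lam m -> R := fun T => (rank T)%:R.
Arguments rank_var R lam m : clear implicits.

Section Weft.
Variables (R : realType) (l e : seq nat).

Definition diff (a b : nat) : R := (nth 0%N l a)%:R - (nth 0%N l b)%:R.

(* sum over a < b of
   (l_a - l_b) e_a e_b (l_a - l_b - 1 + e_a + ... + e_b)^p *)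
Definition pair_sum (p : nat) : R :=
  \sum_(b < size l) \sum_(a < size l | (a < b)%N)
    diff a b * (nth 0%N e a)%:R * (nth 0%N e b)%:R *
    (diff a b - 1 + \sum_(a <= i < b.+1) (nth 0%N e i)%:R) ^+ p.

Definition weft (m : nat) : R :=
  pair_sum 1 / (diff 0 (size l).-1 - 1 + m%:R) ^+ 2.

End Weft.

(* Main.v *)
Require Import Defs.
From mathcomp Require Import all_boot all_order all_algebra.
From mathcomp Require Import all_classical all_reals all_analysis.
From mathcomp Require Import perm measurable_realfun ring lra zify.

Import Order.TTheory GRing.Theory Num.Theory.
Import numFieldNormedType.Exports.

Local Open Scope classical_set_scope.
Local Open Scope ring_scope.

(* The rank generating function of SSYT_{<= m}(lam) is, up to a power of q, the
   product over i < j of the q-integer ratios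
   [lam_i - lam_j + j - i]_q / [j - i]_q: removing the largest entry of a
   tableau leaves a horizontal strip, and the Vandermonde-type alternant
   det(q^(k (lam_i + m - 1 - i))) obeys the same branching recursion.

   The d-th derivative at 0 of ln [n]_{e^t} is c_d (n^d - 1), because
   [n m]_q = [n]_{q^m} [m]_q may be read in two ways; the constant c_d is found
   at n = 2, where the Riccati equation of the hyperbolic tangent shows that it
   is nonzero for even d and zero for odd d >= 3.  Hence
   kappa_d = +- c_d sum_{i < j} ((lam_i - lam_j + j - i)^d - (j - i)^d), and
   grouping the indices into the blocks of equal parts gives the Theta estimate.

   Consequently the standardized cumulants of order d >= 3 are
   O(weft^{-(d/2 - 1)}), so the moments converge to those of N(0, 1).  The
   latter determine the limit: Taylor expansion of the cosine yields the
   convergence of E cos(s W + b), and indicator functions of half-lines are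
   approximated, up to a multiple of 1 + x^2, by polynomials in a cosine of
   large period. *)

(** * Smooth functions and the cumulants of q-integers *)

(** The product formula is obtained as an identity of polynomials, because at q = 1, the point t = 0
    where cumulants are read off, both alternants vanish as soon as m >= 2 and their quotient means
    nothing.

    Its sign alternates along the even d, so the estimate concerns the absolute value of kappa_d.

    With S the numerator of weft and M = l_1 - l_k - 1 + m, bounding all but one of the d - 1 equal
    factors in the pair sum by M gives kappa_d = O(S M^(d-2)), while kappa_2 is of order S.
    Normalizing leaves (M^2 / S)^(d/2-1), which is where weft comes from.

    Polynomials are unbounded on the line, so they cannot approximate a half-line uniformly. Cosines
    are bounded, and the Gaussian even moments (2k)! / (2^k k!) grow slowly enough for their Taylor
    remainders to be small in mean at every frequency. Periodicity spoils the approximation of a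
    half-line only far out, where a small multiple of 1 + x^2, whose mean stays bounded, absorbs the
    error. *)

Section Smooth.
Variable R : realType.
Implicit Types (f g : R -> R) (n : nat).

(* A plain definition, so that class inference is not triggered on the premises
   of the lemmas below, as it would be with [is_derive]. *)
Definition has_derivative f f' := forall x : R, is_derive x 1 f (f' x).

Fixpoint nderivable n f : Prop :=
  if n is n'.+1 then has_derivative f (derive1 f) /\ nderivable n' (derive1 f)
  else True.

Lemma nderivableW n f : nderivable n.+1 f -> nderivable n f.
Proof.
elim: n f => [//|n IH] f [df dn]; split => //.
exact: IH dn.
Qed.

Lemma derive1_has_derivative f f' : has_derivative f f' -> derive1 f = f'.
Proof.
by move=> df; apply/funext => x; have ? := df x; rewrite derive1E derive_val.
Qed.

Lemma nderivableS n f f' :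
  has_derivative f f' -> nderivable n f' -> nderivable n.+1 f.
Proof. by move=> df; rewrite /= (derive1_has_derivative _ _ df). Qed.

Lemma has_derivative_cst (c : R) : has_derivative (fun=> c) (fun=> 0).
Proof. by move=> x; exact: is_derive_cst. Qed.

Lemma has_derivative_id : has_derivative (fun t => t) (fun=> 1).
Proof. by move=> x; exact: is_derive_id. Qed.

Lemma has_derivativeD f g f' g' : has_derivative f f' ->
  has_derivative g g' -> has_derivative (fun t => f t + g t) (fun t => f' t + g' t).
Proof. by move=> hf hg x; exact: (is_deriveD (hf x) (hg x)). Qed.

Lemma has_derivativeM f g f' g' : has_derivative f f' ->
  has_derivative g g' ->
  has_derivative (fun t => f t * g t) (fun t => f' t * g t + f t * g' t).
Proof.
move=> hf hg x; apply: (is_derive_eq (is_deriveM (hf x) (hg x))).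
by rewrite addrC /GRing.scale /= [g x * _]mulrC.
Qed.

Lemma has_derivativeZ f (a : R) f' : has_derivative f f' ->
  has_derivative (fun t => a * f t) (fun t => a * f' t).
Proof.
move=> hf x; apply: (is_derive_eq
  (has_derivativeM _ _ _ _ (has_derivative_cst a) hf x)).
by rewrite mul0r add0r.
Qed.

Lemma has_derivative_comp f g f' g' : has_derivative f f' ->
  has_derivative g g' -> has_derivative (fun t => f (g t)) (fun t => f' (g t) * g' t).
Proof.
move=> hf hg x; exact: (is_derive1_comp (hf (g x)) (hg x)).
Qed.

Lemma has_derivative_scale f (a : R) f' : has_derivative f f' ->
  has_derivative (fun t => f (a * t)) (fun t => a * f' (a * t)).
Proof.
move=> hf x; apply: (is_derive_eq
  (has_derivative_comp _ _ _ _ hf (has_derivativeZ _ a _ has_derivative_id) x)).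
by rewrite mulr1 mulrC.
Qed.

Lemma has_derivative_expM (k : R) :
  has_derivative (fun t => expR (k * t)) (fun t => k * expR (k * t)).
Proof. by apply: has_derivative_scale => x; exact: is_derive_expR. Qed.

Lemma has_derivative_ln f f' : (forall x, 0 < f x) -> has_derivative f f' ->
  has_derivative (fun t => ln (f t)) (fun t => f' t * (f t)^-1).
Proof.
move=> f0 hf x.
have hl : is_derive (f x) 1 (@ln R) (f x)^-1 by exact: is_derive1_ln.
by apply: (is_derive_eq (is_derive1_comp hl (hf x))); rewrite mulrC.
Qed.

Lemma has_derivative_inv f f' : (forall x, 0 < f x) -> has_derivative f f' ->
  has_derivative (fun t => (f t)^-1)
                 (fun t => -1 * (f' t * ((f t)^-1 * (f t)^-1))).
Proof.
move=> f0 hf x; have fn : f x != 0 by rewrite gt_eqF.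
by apply: (is_derive_eq (is_deriveV fn (hf x))); rewrite /GRing.scale /=; field.
Qed.

Lemma nderivable_cst n (c : R) : nderivable n (fun=> c).
Proof.
elim: n c => [//|n IH] c.
by apply: nderivableS (has_derivative_cst c) _.
Qed.

Lemma nderivableD n f g :
  nderivable n f -> nderivable n g -> nderivable n (fun t => f t + g t).
Proof.
elim: n f g => [//|n IH] f g [hf hf'] [hg hg'].
by apply: nderivableS (has_derivativeD _ _ _ _ hf hg) _; exact: IH.
Qed.

Lemma nderivableM n f g :
  nderivable n f -> nderivable n g -> nderivable n (fun t => f t * g t).
Proof.
elim: n f g => [//|n IH] f g sf sg; have [hf hf'] := sf; have [hg hg'] := sg.
apply: nderivableS (has_derivativeM _ _ _ _ hf hg) _.
by apply: nderivableD; apply: IH => //; exact: nderivableW.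
Qed.

Lemma nderivable_scale n f (a : R) :
  nderivable n f -> nderivable n (fun t => f (a * t)).
Proof.
elim: n f => [//|n IH] f [hf hf'].
apply: nderivableS (has_derivative_scale _ a _ hf) _.
by apply: nderivableM; [exact: nderivable_cst|exact: IH].
Qed.

Lemma nderivable_inv n f : (forall x, 0 < f x) ->
  nderivable n f -> nderivable n (fun t => (f t)^-1).
Proof.
move=> f0; elim: n => [//|n IH] sf; have [hf hf'] := sf.
apply: nderivableS (has_derivative_inv _ _ f0 hf) _.
have ? := IH (nderivableW _ _ sf).
by do ![apply: nderivableM => //]; exact: nderivable_cst.
Qed.

Lemma nderivable_ln n f : (forall x, 0 < f x) ->
  nderivable n f -> nderivable n (fun t => ln (f t)).
Proof.
move=> f0; case: n => [//|n] sf; have [hf hf'] := sf.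
apply: nderivableS (has_derivative_ln _ _ f0 hf) _.
by apply: nderivableM => //; apply: nderivable_inv => //; exact: nderivableW.
Qed.

Lemma nderivable_expM n (k : R) : nderivable n (fun t => expR (k * t)).
Proof.
elim: n => [//|n IH]; apply: nderivableS (has_derivative_expM k) _.
by apply: nderivableM => //; exact: nderivable_cst.
Qed.

Lemma nderivable_id n : nderivable n (fun t => t).
Proof.
by case: n => [//|n]; apply: nderivableS has_derivative_id _;
  exact: nderivable_cst.
Qed.

Lemma derive1n_cst n (c x : R) : derive1n n.+1 (fun=> c) x = 0.
Proof.
elim: n c => [|n IH] c; rewrite derive1Sn
  (derive1_has_derivative _ _ (has_derivative_cst c)) //.
Qed.

Lemma derive1nD n f g x : nderivable n f -> nderivable n g ->
  derive1n n (fun t => f t + g t) x = derive1n n f x + derive1n n g x.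
Proof.
elim: n f g => [//|n IH] f g [hf hf'] [hg hg']; rewrite !derive1Sn.
by rewrite (derive1_has_derivative _ _ (has_derivativeD _ _ _ _ hf hg)) IH.
Qed.

Lemma derive1nZ n f (a x : R) : nderivable n f ->
  derive1n n (fun t => a * f t) x = a * derive1n n f x.
Proof.
elim: n f => [//|n IH] f [hf hf']; rewrite !derive1Sn.
by rewrite (derive1_has_derivative _ _ (has_derivativeZ _ a _ hf)) IH.
Qed.

Lemma nderivable_sum n (I : Type) (r : seq I) (P : pred I) (F : I -> R -> R) :
  (forall i, P i -> nderivable n (F i)) ->
  nderivable n (fun t => \sum_(i <- r | P i) F i t).
Proof.
move=> hF; rewrite (_ : (fun _ => _) = \sum_(i <- r | P i) F i).
  apply: (big_ind (nderivable n)) => //; [exact: nderivable_cst|exact: nderivableD].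
by apply/funext => t; rewrite fct_sumE.
Qed.

Lemma derive1n_sum n (I : Type) (r : seq I) (P : pred I) (F : I -> R -> R) x :
  (forall i, P i -> nderivable n (F i)) ->
  derive1n n (fun t => \sum_(i <- r | P i) F i t) x =
  \sum_(i <- r | P i) derive1n n (F i) x.
Proof.
move=> hF; rewrite (_ : (fun _ => _) = \sum_(i <- r | P i) F i); last first.
  by apply/funext => t; rewrite fct_sumE.
suff [] : nderivable n (\sum_(i <- r | P i) F i) /\
  derive1n n (\sum_(i <- r | P i) F i) x =
  \sum_(i <- r | P i) derive1n n (F i) x by [].
apply: (big_ind2 (fun f v => nderivable n f /\ derive1n n f x = v)).
- split; first exact: nderivable_cst.
  by case: n {hF} => // n; rewrite derive1n_cst.
- move=> f v g w [sf <-] [sg <-].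
  by split; [exact: nderivableD|exact: derive1nD].
- by move=> i Pi; split => //; exact: hF.
Qed.

Lemma derive1n_scale n f (a x : R) : nderivable n f ->
  derive1n n (fun t => f (a * t)) x = a ^+ n * derive1n n f (a * x).
Proof.
elim: n f => [|n IH] f sf; first by rewrite mul1r.
have [hf hf'] := sf.
rewrite !derive1Sn (derive1_has_derivative _ _ (has_derivative_scale _ a _ hf)).
by rewrite derive1nZ ?IH ?exprS ?mulrA //; exact: nderivable_scale.
Qed.

Lemma derive1n_expM n (k x : R) :
  derive1n n (fun t => expR (k * t)) x = k ^+ n * expR (k * x).
Proof.
elim: n => [|n IH]; first by rewrite mul1r.
rewrite derive1Sn (derive1_has_derivative _ _ (has_derivative_expM k)).
by rewrite derive1nZ ?IH ?exprS ?mulrA //; exact: nderivable_expM.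
Qed.

Lemma derive1n_linear n (a x : R) : derive1n n.+2 (fun t => a * t) x = 0.
Proof.
rewrite derive1nZ; last exact: nderivable_id.
rewrite derive1Sn (derive1_has_derivative _ _ has_derivative_id).
by rewrite derive1n_cst mulr0.
Qed.

(** Leibniz' rule. It turns each first-order equation met below (the Riccati equation of [v], M' =
    K' M, and m' = s m) into a recursion on derivatives at 0. *)
Lemma derive1nM n f g x : nderivable n f -> nderivable n g ->
  derive1n n (fun t => f t * g t) x =
  \sum_(i < n.+1) 'C(n, i)%:R * derive1n i f x * derive1n (n - i) g x.
Proof.
elim: n f g => [|n IH] f g sf sg; first by rewrite big_ord1 bin0 mul1r.
have [hf hf'] := sf; have [hg hg'] := sg.
have hfW := nderivableW _ _ sf; have hgW := nderivableW _ _ sg.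
rewrite derive1Sn (derive1_has_derivative _ _ (has_derivativeM _ _ _ _ hf hg)).
rewrite derive1nD; [|exact: nderivableM..].
rewrite !IH // big_ord_recr [X in _ + X]big_ord_recl /=.
rewrite [RHS]big_ord_recl [X in _ = _ + X]big_ord_recr /= !bin0 !binn !subnn.
rewrite -!derive1Sn !subn0.
rewrite [LHS]addrACA [X in X + _ = _]addrC [X in _ + X = _]addrC -addrA.
congr (_ + _); rewrite addrA; congr (_ + _).
rewrite -big_split /=; apply: eq_bigr => i _.
rewrite /bump /= add1n -!derive1Sn binS natrD subSS.
have -> : (n - i = (n - i.+1).+1)%N by rewrite subnSK.
by rewrite add0n -derive1nS; ring.
Qed.

End Smooth.

Lemma ln_prod (R : realType) (I : Type) (r : seq I) (P : pred I) (F : I -> R) :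
  (forall i, P i -> 0 < F i) ->
  ln (\prod_(i <- r | P i) F i) = \sum_(i <- r | P i) ln (F i).
Proof.
move=> F0; suff [] : 0 < \prod_(i <- r | P i) F i /\
  ln (\prod_(i <- r | P i) F i) = \sum_(i <- r | P i) ln (F i) by [].
apply: (big_ind2 (fun x y => 0 < x /\ ln x = y)).
- by rewrite ltr01 ln1.
- move=> x _ y _ [x0 <-] [y0 <-]; split; first exact: mulr_gt0.
  by rewrite lnM ?posrE.
- by move=> i Pi; split => //; exact: F0.
Qed.

(** * Cumulants of q-integers *)

Section QIntegerCumulants.
Variable R : realType.

Definition qint (n : nat) (q : R) : R := \sum_(k < n) q ^+ k.

Lemma qint_gt0 n q : (0 < n)%N -> 0 < q -> 0 < qint n q.
Proof.
case: n => // n _ q0; rewrite /qint big_ord_recl expr0 ltr_wpDr //.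
by apply: sumr_ge0 => i _; rewrite exprn_ge0 // ltW.
Qed.

Definition log_qint (n : nat) (t : R) : R := ln (qint n (expR t)).

(** For n > 0 and d > 0 this is the d-th cumulant of the uniform law on {0, ..., n-1}: its cumulant
    generating function differs from [log_qint n] by the constant ln n. *)
Definition qint_cumulant (d n : nat) : R := derive1n d (log_qint n) 0.

Lemma nderivable_qint d n : nderivable R d (fun t => qint n (expR t)).
Proof.
apply: nderivable_sum => i _.
rewrite (_ : (fun _ => _) = fun t => expR (i%:R * t)).
  exact: nderivable_expM.
by apply/funext => t; rewrite -expRM_natl.
Qed.

Lemma nderivable_log_qint d n : (0 < n)%N -> nderivable R d (log_qint n).
Proof.
move=> n0; apply: nderivable_ln; last exact: nderivable_qint.
by move=> x; rewrite qint_gt0 // expR_gt0.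
Qed.

(** Division with remainder: every exponent below n m is uniquely m a + b with a < n and b < m. *)
Lemma qintM n m q : qint (n * m) q = qint n (q ^+ m) * qint m q.
Proof.
rewrite /qint mulrC big_distrl /=; elim: n => [|n IH].
  by rewrite mul0n big_ord0 big1 // => i _; rewrite big_ord0 mulr0.
rewrite mulSnr big_split_ord /= IH.
under [RHS]eq_bigr do rewrite big_ord_recr /= mulrDr.
rewrite big_split /=; congr (_ + _); apply: eq_bigr => i _.
by rewrite exprD -exprM [(m * n)%N]mulnC mulrC.
Qed.

Lemma qint_cumulantM d n m : (0 < n)%N -> (0 < m)%N ->
  qint_cumulant d (n * m) = m%:R ^+ d * qint_cumulant d n + qint_cumulant d m.
Proof.
move=> n0 m0; rewrite /qint_cumulant.
rewrite (_ : log_qint (n * m) = fun t => log_qint n (m%:R * t) + log_qint m t).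
  rewrite derive1nD; [|exact/nderivable_scale/nderivable_log_qint|
                       exact: nderivable_log_qint].
  by rewrite derive1n_scale ?mulr0 //; exact: nderivable_log_qint.
apply/funext => t; rewrite /log_qint qintM expRM_natl lnM //.
  by rewrite posrE qint_gt0 // exprn_gt0 // expR_gt0.
by rewrite posrE qint_gt0 // expR_gt0.
Qed.

(* Both readings of [qint_cumulantM] give [qint_cumulant d n * (2 ^ d - 1) =
   qint_cumulant d 2 * (n ^ d - 1)]. *)
Lemma qint_cumulantE d n : (0 < d)%N -> (0 < n)%N ->
  qint_cumulant d n = qint_cumulant d 2 / (2 ^+ d - 1) * (n%:R ^+ d - 1).
Proof.
move=> d0 n0; have := qint_cumulantM d n 2 n0 isT; rewrite mulnC (qint_cumulantM d 2 n isT n0).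
move=> h; have e : (2 ^+ d - 1 : R) != 0.
  by rewrite subr_eq0 gt_eqF // exprn_egt1 ?ltr1n // -lt0n.
by apply: (mulIf e); rewrite mulrAC divfK //; lra.
Qed.

(** This is tanh(t/2), the logarithmic derivative of 1 + e^t doubled and recentred. In this form the
    Riccati equation v' = (1 - v^2) / 2 has no linear term, so parity passes through the
    recursion. *)
Let v (t : R) : R := 2 * (expR t / (1 + expR t)) - 1.

Let expRD1_gt0 (t : R) : 0 < 1 + expR t.
Proof. by rewrite addr_gt0 // expR_gt0. Qed.

Let log_qint2 : log_qint 2 = fun t => ln (1 + expR t).
Proof.
by apply/funext => t; rewrite /log_qint /qint !big_ord_recl big_ord0 addr0.
Qed.

Let has_derivative_expR : has_derivative R (fun t => expR t) (fun t => expR t).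
Proof. by move=> x; exact: is_derive_expR. Qed.

Let has_derivative_1exp :
  has_derivative R (fun t => 1 + expR t) (fun t => 0 + expR t).
Proof.
exact: has_derivativeD (has_derivative_cst _ _) has_derivative_expR.
Qed.

Let derive1_log_qint2 : derive1 (log_qint 2) = fun t => 2^-1 + 2^-1 * v t.
Proof.
rewrite log_qint2.
rewrite (derive1_has_derivative _ _ _
  (has_derivative_ln _ _ _ expRD1_gt0 has_derivative_1exp)).
by apply/funext => t; rewrite add0r /v; lra.
Qed.

Let has_derivative_v : has_derivative R v (fun t => 2^-1 + - 2^-1 * (v t * v t)).
Proof.
have h := has_derivativeD _ _ _ _ _ (has_derivativeZ _ _ 2 _
  (has_derivativeM _ _ _ _ _ has_derivative_expR
    (has_derivative_inv _ _ _ expRD1_gt0 has_derivative_1exp)))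
  (has_derivative_cst _ (-1)).
move=> x; apply: (is_derive_eq (h x)); rewrite /v.
by have := lt0r_neq0 (expRD1_gt0 x); move=> ?; field.
Qed.

Let nderivable_v n : nderivable R n v.
Proof.
elim: n => [//|n IH]; apply: nderivableS has_derivative_v _.
apply: nderivableD; first exact: nderivable_cst.
by apply: nderivableM; [exact: nderivable_cst|exact: nderivableM].
Qed.

Let v0 : v 0 = 0. Proof. by rewrite /v expR0; field. Qed.

Let derive1n_vS n : derive1n n.+2 v 0 = - 2^-1 *
  \sum_(i < n.+2) 'C(n.+1, i)%:R * derive1n i v 0 * derive1n (n.+1 - i) v 0.
Proof.
rewrite derive1Sn (derive1_has_derivative _ _ _ has_derivative_v).
rewrite derive1nD; [|exact: nderivable_cst|]; last first.
  by apply: nderivableM; [exact: nderivable_cst|exact: nderivableM].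
rewrite derive1n_cst add0r derive1nZ; last exact: nderivableM.
by rewrite derive1nM.
Qed.

(** In the recursion for the derivative of order n + 2 the indices i and n + 1 - i add up to n + 1.
    If n is even, one of them is even and every product vanishes. If n is odd, the products with
    even indices vanish and those with odd indices all carry the sign (-1)^((n-1)/2), so nothing
    cancels; the term i = 1 is nonzero. *)
Let derive1n_v n : if odd n then is_true (0 < (-1) ^+ n./2 * derive1n n v 0)
                   else derive1n n v 0 = 0.
Proof.
elim/ltn_ind: n => -[|[|n]] IH.
- by rewrite /= v0.
- rewrite derive1Sn (derive1_has_derivative _ _ _ has_derivative_v) /= v0; lra.
rewrite derive1n_vS /= negbK; case: ifP => on.
  rewrite exprS; set s := (-1) ^+ _; set S := \sum_(i < n.+2) _.
  suff : 0 < s * S by lra.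
  rewrite /S mulr_sumr (bigD1 (inord 1)) //= inordK //.
  apply: ltr_wpDr; last first.
    rewrite subSS subn0 bin1 -mulrA mulrCA mulr_gt0 ?ltr0Sn // mulrCA.
    rewrite mulr_gt0 //; first by have := IH 1%N isT; rewrite /= mul1r.
    by have := IH n (leqnSn _); rewrite on.
  apply: sumr_ge0 => i _; have ile : (i <= n.+1)%N by rewrite -ltnS.
  have := IH i (ltn_ord i); case: ifP => oi.
    have := IH (n.+1 - i)%N; rewrite oddB //= on oi /= ltnS leq_subr => /(_ isT).
    move=> h1 h2; rewrite (_ : s = (-1) ^+ i./2 * (-1) ^+ (n.+1 - i)./2).
      rewrite mulrACA [X in _ <= X]mulrC mulrCA.
      rewrite [X in 0 <= X](_ : _ = 'C(n.+1, i)%:R * ((-1) ^+ i./2 * derive1n i v 0) * ((-1) ^+ (n.+1 - i)./2 * derive1n (n.+1 - i) v 0)); last by ring.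
      by rewrite mulr_ge0 ?ltW // mulr_gt0 // ltr0n bin_gt0.
    by rewrite -exprD /s; congr (_ ^+ _); lia.
  by move=> ->; rewrite mulr0 mul0r mulr0.
rewrite big1 ?mulr0 // => i _; have ile : (i <= n.+1)%N by rewrite -ltnS.
have := IH i (ltn_ord i); case: ifP => oi; last by move=> ->; rewrite mulr0 mul0r.
have := IH (n.+1 - i)%N; rewrite oddB //= on oi /= ltnS leq_subr => /(_ isT) ->.
by rewrite mulr0.
Qed.

Let qint_cumulant2 d : qint_cumulant d.+2 2 = 2^-1 * derive1n d.+1 v 0.
Proof.
rewrite /qint_cumulant derive1Sn derive1_log_qint2 derive1nD.
- by rewrite derive1n_cst add0r derive1nZ.
- exact: nderivable_cst.
- by apply: nderivableM => //; exact: nderivable_cst.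
Qed.

Lemma qint_cumulant2_even d : (2 <= d)%N -> ~~ odd d -> qint_cumulant d 2 != 0.
Proof.
case: d => [|[|d]] // _; rewrite /= negbK qint_cumulant2 => od.
have := derive1n_v d.+1; rewrite [odd _]/= od => h.
apply/eqP => h0; have z : derive1n d.+1 v 0 = 0 by lra.
by move: h; rewrite z mulr0 ltxx.
Qed.

Lemma qint_cumulant2_odd d : (2 <= d)%N -> odd d -> qint_cumulant d 2 = 0.
Proof.
case: d => [|[|d]] // _; rewrite 2!oddS negbK qint_cumulant2 => od.
by have := derive1n_v d.+1; rewrite oddS od => ->; rewrite mulr0.
Qed.

End QIntegerCumulants.

(** * The branching rule for semistandard tableaux *)

Section Branching.
Implicit Types (m : nat) (s mu r : seq nat) (t : seq (seq nat)).

(** The sequences interlacing s. They have one part fewer because s carries one part, possibly 0,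
    for each available letter, and the letters other than the largest fill at most one row less. *)
Fixpoint strips s : seq (seq nat) :=
  if s is x :: s' then
    if s' is y :: _ then
      [seq z :: mu | z <- iota y (x.+1 - y), mu <- strips s']
    else [:: [::]]
  else [::].

Lemma mem_strips s mu : s != [::] ->
  reflect (size mu = (size s).-1 /\
           forall i, (i < size mu)%N -> (nth 0 s i.+1 <= nth 0 mu i <= nth 0 s i)%N)
          (mu \in strips s).
Proof.
elim: s mu => [//|x [|y s] IH] mu _.
  rewrite inE; apply: (iffP eqP) => [->//|[]]; by case: mu.
rewrite [strips _]/= -/(strips (y :: s)).
apply: (iffP allpairsP) => [[[z nu] /= [hz hnu ->]]|[]].
  have [hs hi] := IH nu isT hnu; split; first by rewrite /= hs.
  by case=> [|i] hI; [move: hz; rewrite mem_iota /=; lia|exact: hi].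
case: mu => [//|z nu] hs hi; exists (z, nu); split => //=.
  by have := hi 0%N isT; rewrite mem_iota /=; lia.
apply/IH => //; split; first by case: hs.
by move=> i hI; exact: (hi i.+1 hI).
Qed.

Lemma strips_uniq s : uniq (strips s).
Proof.
elim: s => [//|x [|y s] IH] //; rewrite [strips _]/= -/(strips (y :: s)).
by apply: allpairs_uniq => //; [exact: iota_uniq|move=> [? ?] [? ?] _ _ [-> ->]].
Qed.

(** For i = m the row lies outside t and the default [[::]] is meant: the last row consists of
    copies of m alone. *)
Definition extend m s t : seq (seq nat) :=
  [seq nth [::] t i ++ nseq (nth 0%N s i - size (nth [::] t i)) m
  | i <- iota 0 m.+1].

Definition restrict m t : seq (seq nat) :=
  [seq [seq x <- r | (x < m)%N] | r <- take m t].

Fixpoint tabs m s : seq (seq (seq nat)) :=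
  if m is m'.+1 then [seq extend m' s t | mu <- strips s, t <- tabs m' mu]
  else [:: [::]].

(* Semistandard tableaux as lists of rows, with entries in [0, m). *)
Definition is_tab m s t : Prop :=
  [/\ size t = m, shape t = s,
      forall i, (i < m)%N -> sorted leq (nth [::] t i),
      forall i x, (i < m)%N -> x \in nth [::] t i -> (i <= x < m)%N
    & forall i j, (i.+1 < m)%N -> (j < size (nth [::] t i.+1))%N ->
        (nth 0 (nth [::] t i) j < nth 0 (nth [::] t i.+1) j)%N].

Lemma nth_shape t i : nth 0%N (shape t) i = size (nth [::] t i).
Proof.
case: (ltnP i (size t)) => h; first by rewrite (nth_map [::]).
by rewrite !nth_default // size_map.
Qed.

Lemma sorted_geq_nthS s i : sorted geq s -> (nth 0 s i.+1 <= nth 0 s i)%N.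
Proof.
elim: s i => [|x [|y s] IH] [|i] //=; first by case/andP.
by case/andP=> _ /IH; exact.
Qed.

Lemma nth_extend m s t i : (i <= m)%N -> nth [::] (extend m s t) i =
  nth [::] t i ++ nseq (nth 0%N s i - size (nth [::] t i)) m.
Proof. by move=> h; rewrite (nth_map 0%N) ?size_iota // nth_iota. Qed.

Lemma nth_restrict m t i : (i < m)%N ->
  nth [::] (restrict m t) i = [seq x <- nth [::] t i | (x < m)%N].
Proof.
move=> h; case: (ltnP i (size (take m t))) => h'.
  by rewrite (nth_map [::]) // nth_take.
rewrite nth_default ?size_map // nth_default //.
by move: h'; rewrite size_take; case: ifP; lia.
Qed.

(** Column strictness is where the strip condition enters: s_{i+1} <= mu_i puts an old entry, hence
    one below m, above every cell of row i + 1. *)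
Lemma extend_tab m s mu t : sorted geq s -> size s = m.+1 ->
  mu \in strips s -> is_tab m mu t -> is_tab m.+1 s (extend m s t).
Proof.
move=> ss szs /mem_strips; rewrite -size_eq0 szs => /(_ isT)[szmu hmu].
case=> szt sh srt ent col.
have szti i : size (nth [::] t i) = nth 0%N mu i by rewrite -sh nth_shape.
have tm : nth [::] t m = [::] by rewrite nth_default // szt.
have tle i : (i <= m)%N -> (size (nth [::] t i) <= nth 0%N s i)%N.
  rewrite leq_eqVlt => /orP[/eqP->|im]; first by rewrite tm.
  by rewrite szti; have := hmu i; rewrite szmu im => /(_ isT)/andP[].
have szE i : (i <= m)%N -> size (nth [::] (extend m s t) i) = nth 0%N s i.
  by move=> im; rewrite nth_extend // size_cat size_nseq subnKC // tle.
have mem_t i x : x \in nth [::] t i -> (i <= x < m)%N.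
  case: (ltnP i m) => [im|mi]; first exact: ent.
  by rewrite nth_default // szt.
split.
- by rewrite size_map size_iota.
- have szsh : size (shape (extend m s t)) = m.+1.
    by rewrite /shape !size_map size_iota.
  apply: (@eq_from_nth _ 0%N); first by rewrite szsh szs.
  by move=> i; rewrite szsh => im; rewrite nth_shape szE.
- move=> i im; rewrite nth_extend // sorted_pairwise ?pairwise_cat; last exact: leq_trans.
  apply/and3P; split.
  + apply/allrelP => x y hx; rewrite mem_nseq => /andP[_ /eqP->].
    by have := mem_t _ _ hx; lia.
  + case: (ltnP i m) => im'; last by rewrite nth_default // szt.
    by rewrite -sorted_pairwise ?srt //; exact: leq_trans.
  + by elim: (_ - _)%N => //= k ->; rewrite andbT; apply/allP => x; rewrite mem_nseq => /andP[_ /eqP->].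
- move=> i x im; rewrite nth_extend // mem_cat => /orP[/mem_t|]; first by lia.
  by rewrite mem_nseq => /andP[_ /eqP->]; lia.
- move=> i j im; rewrite szE // => hj; have im' : (i < m)%N by [].
  rewrite !nth_extend ?(ltnW im') //.
  have := hmu i; rewrite szmu /= im' => /(_ isT) /andP[h1 h2].
  rewrite !nth_cat !nth_nseq.
  have -> : (j < size (nth [::] t i))%N by rewrite szti; lia.
  case: ifP => hj'.
    apply: col => //; case: (ltnP i.+1 m) => // h.
    by move: hj'; rewrite nth_default ?szt.
  rewrite ifT; last by lia.
  have : nth 0%N (nth [::] t i) j \in nth [::] t i by apply: mem_nth; rewrite szti; lia.
  by move/mem_t; lia.
Qed.

Lemma sorted_filter_ltn m r : sorted leq r -> all (fun x => x <= m)%N r ->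
  let f := [seq x <- r | (x < m)%N] in r = f ++ nseq (size r - size f) m.
Proof.
move=> /= sr ar; elim: r sr ar => [//|x r IH] /= px /andP[xm ar].
have sr := path_sorted px; case: ltnP => xm' /=.
  by rewrite -IH.
have x_m : x = m by lia.
have h : all (fun y => y == m) r.
  apply/allP => y yr; have := order_path_min leq_trans px.
  by move/allP/(_ y yr); have := allP ar y yr; lia.
have -> : [seq y <- r | (y < m)%N] = [::].
  apply/eqP; rewrite -[_ == _]negbK -has_filter -all_predC.
  by apply: sub_all h => y /eqP ->; rewrite /= ltnn.
rewrite /= x_m; congr (_ :: _); rewrite -(all_pred1P _ _ h).
by [].
Qed.

Lemma restrict_tab m s t : sorted geq s -> is_tab m.+1 s t ->
  [/\ shape (restrict m t) \in strips s,
      is_tab m (shape (restrict m t)) (restrict m t)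
    & t = extend m s (restrict m t)].
Proof.
move=> ss [szt sh srt ent col].
have szti i : size (nth [::] t i) = nth 0%N s i by rewrite -sh nth_shape.
have szs : size s = m.+1 by rewrite -sh /shape size_map.
have szr : size (restrict m t) = m by rewrite size_map size_takel // szt.
have rowE i : (i < m)%N -> nth [::] t i = nth [::] (restrict m t) i ++
    nseq (nth 0%N s i - size (nth [::] (restrict m t) i)) m.
  move=> im; rewrite nth_restrict // -szti; apply: sorted_filter_ltn.
    by apply: srt; rewrite ltnW.
  by apply/allP => x /(ent _ _ (ltnW im)); lia.
have strip i : (i < m)%N ->
    (nth 0 s i.+1 <= size (nth [::] (restrict m t) i) <= nth 0 s i)%N.
  move=> im; apply/andP; split; last first.
    by rewrite nth_restrict // -szti size_filter count_size.
  (* Otherwise the first cell of row i holding m would have a cell below it, whose entry would have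
     to exceed m. *)
  rewrite leqNgt; apply/negP => hlt.
  have hj := col i (size (nth [::] (restrict m t) i)) im.
  move: (hj); rewrite szti => /(_ hlt); rewrite [nth [::] t i]rowE //.
  rewrite nth_cat ltnn subnn nth_nseq ifT.
    have : nth 0%N (nth [::] t i.+1) (size (nth [::] (restrict m t) i)) \in nth [::] t i.+1.
      by apply: mem_nth; rewrite szti.
    by move/(ent i.+1 _ im); lia.
  by have := sorted_geq_nthS s i ss; lia.
have lastE : nth [::] t m = nseq (nth 0%N s m) m.
  rewrite -szti; apply/all_pred1P/allP => x /(ent _ _ (leqnn _)) /=; lia.
split.
- apply/mem_strips; first by rewrite -size_eq0 szs.
  rewrite /shape size_map szr szs; split => // i im.
  by rewrite nth_shape strip.
- split => //.
  + move=> i im; rewrite nth_restrict //; apply: sorted_filter; first exact: leq_trans.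
    by apply: srt; rewrite ltnW.
  + move=> i x im; rewrite nth_restrict // mem_filter => /andP[xm].
    by move/(ent _ _ (ltnW im)); lia.
  + move=> i j im hj.
    have hi := strip i (ltnW im); have hi1 := strip i.+1 im.
    have := col i j (ltnW im); rewrite szti.
    rewrite (rowE i) ?(rowE i.+1) ?(ltnW im) // !nth_cat hj.
    by rewrite ifT; [apply; lia|lia].
- apply: (@eq_from_nth _ [::]); first by rewrite size_map size_iota.
  move=> i; rewrite szt => im; rewrite nth_extend //.
  move: im; rewrite ltnS leq_eqVlt => /orP[/eqP->|im]; last exact: rowE.
  by rewrite [nth [::] (restrict m t) m]nth_default ?szr //= subn0.
Qed.

Lemma restrict_extend m s mu t : is_tab m mu t -> restrict m (extend m s t) = t.
Proof.
move=> [szt _ _ ent _]; apply: (@eq_from_nth _ [::]).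
  by rewrite size_map size_takel ?size_map ?size_iota.
move=> i; rewrite size_map size_takel ?size_map ?size_iota // => im.
rewrite nth_restrict // nth_extend; last exact: ltnW.
rewrite filter_cat (all_filterP _); last first.
  by apply/allP => x /(ent _ _ im); lia.
rewrite (_ : [seq _ <- nseq _ _ | _] = [::]) ?cats0 //.
by rewrite filter_nseq ltnn.
Qed.

Lemma strips_sorted s mu : sorted geq s -> s != [::] -> mu \in strips s ->
  sorted geq mu.
Proof.
move=> ss s0 /(mem_strips _ _ s0)[szmu hmu].
apply/(sortedP 0%N) => i hi /=.
have h1 := hmu i (ltnW hi); have h2 := hmu i.+1 hi; lia.
Qed.

Lemma mem_tabs m s t : sorted geq s -> size s = m ->
  reflect (is_tab m s t) (t \in tabs m s).
Proof.
elim: m s t => [|m IH] s t ss szs.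
  rewrite inE; apply: (iffP eqP) => [->|[szt _ _ _ _]]; last by case: t szt.
  by split => //; case: s szs {ss}.
have s0 : s != [::] by rewrite -size_eq0 szs.
have IHmu mu : mu \in strips s -> forall t, reflect (is_tab m mu t) (t \in tabs m mu).
  move=> hmu t'; apply: IH; first exact: strips_sorted hmu.
  by have [-> _] := mem_strips _ _ s0 hmu; rewrite szs.
apply: (iffP allpairsPdep) => [[mu [t' [hmu /(IHmu _ hmu) ht ->]]]|ht].
  exact: extend_tab ht.
have [h1 h2 h3] := restrict_tab _ _ _ ss ht.
by exists (shape (restrict m t)), (restrict m t); split => //; apply/IHmu.
Qed.

(** An extended tableau determines the pair it came from: [restrict] gives back t, and mu is the
    shape of t. *)
Lemma tabs_uniq m s : sorted geq s -> size s = m -> uniq (tabs m s).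
Proof.
elim: m s => [//|m IH] s ss szs; have s0 : s != [::] by rewrite -size_eq0 szs.
have hst mu : mu \in strips s -> sorted geq mu /\ size mu = m.
  move=> hmu; split; first exact: strips_sorted hmu.
  by have [-> _] := mem_strips _ _ s0 hmu; rewrite szs.
apply: allpairs_uniq_dep; first exact: strips_uniq.
  by move=> mu /hst[? ?]; exact: IH.
move=> _ _ /allpairsPdep[mu [t [hmu ht ->]]] /allpairsPdep[nu [u [hnu hu ->]]] /=.
have [smu zmu] := hst _ hmu; have [snu znu] := hst _ hnu.
move: ht => /(mem_tabs _ _ _ smu zmu) ht; move: hu => /(mem_tabs _ _ _ snu znu) hu.
move/(congr1 (restrict m)); rewrite (restrict_extend _ _ _ _ ht) (restrict_extend _ _ _ _ hu).
move=> tu; move: ht hu; rewrite -{}tu => -[_ <- _ _ _] [_ <- _ _ _].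
by [].
Qed.

Definition corank m t : nat := (\sum_(r <- t) \sum_(x <- r) (m.-1 - x))%N.

(** Weights are counted down from the largest letter: a new letter m weighs 0 and each of the |mu|
    older entries gains 1. This is why the branching is graded by [corank] and not by the rank. *)
Lemma corank_extend m s mu t : is_tab m mu t ->
  corank m.+1 (extend m s t) = (sumn mu + corank m t)%N.
Proof.
move=> [szt sh _ ent _]; rewrite /corank big_map -/(index_iota 0 m.+1) big_nat_recr //=.
rewrite [nth [::] t m]nth_default ?szt // cat0s subn0.
have hns k : (\sum_(x <- nseq k m) (m - x))%N = 0%N.
  by rewrite big_seq big1 // => x; rewrite mem_nseq => /andP[_ /eqP->]; rewrite subnn.
rewrite hns addn0 -sh sumnE big_map !(big_nth [::]) szt -big_split /=.
rewrite big_nat [RHS]big_nat; apply: eq_bigr => i im.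
rewrite big_cat /= hns addn0 -sum1_size -big_split /=.
rewrite big_seq [RHS]big_seq; apply: eq_bigr => x.
by move/(ent _ _ im); lia.
Qed.

End Branching.

(** * The product formula *)

Section PrincipalSpecialization.
Variables (A : comPzRingType) (p : A).
Implicit Types (m : nat) (s mu : seq nat).

Definition corank_gf m s : A := \sum_(t <- tabs m s) p ^+ corank m t.

(** Numerator of the bialternant formula for the Schur function of s, evaluated at 1, p, ...,
    p^(m-1). *)
Definition vdm m s : A :=
  \det (\matrix_(i < m, k < m) p ^+ (k * (nth 0%N s i + (m.-1 - i)))).

Lemma corank_gfS m s : sorted geq s -> size s = m.+1 ->
  corank_gf m.+1 s = \sum_(mu <- strips s) p ^+ sumn mu * corank_gf m mu.
Proof.
move=> ss szs; have s0 : s != [::] by rewrite -size_eq0 szs.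
rewrite /corank_gf /= big_allpairs_dep big_seq [RHS]big_seq.
apply: eq_bigr => mu hmu; rewrite big_distrr /= big_seq [RHS]big_seq.
have smu := strips_sorted _ _ ss s0 hmu.
have [zmu _] := mem_strips _ _ s0 hmu; rewrite szs in zmu.
apply: eq_bigr => t /(mem_tabs _ _ _ smu zmu) ht.
by rewrite (corank_extend _ _ _ _ ht) exprD.
Qed.

(** Once s is fixed, the interlacing conditions on the parts of mu are independent of each other, so
    the strips form a box and the sum factors. *)
Lemma sum_strips_prod s (f : nat -> nat -> A) : s != [::] ->
  \sum_(mu <- strips s) \prod_(j < (size s).-1) f j (nth 0%N mu j) =
  \prod_(j < (size s).-1)
     \sum_(nth 0%N s j.+1 <= z < (nth 0%N s j).+1) f j z.
Proof.
elim: s f => [//|x [|y s] IH] f _; first by rewrite big_seq1 !big_ord0.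
rewrite [strips _]/= -/(strips (y :: s)) big_allpairs_dep /=.
rewrite [RHS]big_ord_recl /= -(IH (fun j => f j.+1)) // big_distrl /=.
apply: eq_bigr => z _; rewrite big_distrr /=; apply: eq_bigr => mu _.
by rewrite big_ord_recl.
Qed.

Lemma geom_sum (x : A) c a b : (a <= b)%N ->
  x ^+ (b + c) - x ^+ (a + c) = (x - 1) * \sum_(a <= z < b) x ^+ (z + c).
Proof.
move=> ab; rewrite big_distrr /= -(telescope_sumr (fun z => x ^+ (z + c)) ab).
by apply: eq_bigr => z _; rewrite mulrBl mul1r addSn exprS.
Qed.

(* Subtracting consecutive rows of the alternant leaves a matrix of geometric
   sums over the intervals [s_{j+1}, s_j], whose determinant is expanded
   multilinearly into a sum over horizontal strips. *)
Lemma vdmS m s : sorted geq s -> size s = m.+1 ->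
  vdm m.+1 s = (-1) ^+ m * \prod_(k < m) (p ^+ k.+1 - 1) *
    p ^+ (\sum_(i < m) (m.-1 - i)) *
    \sum_(mu <- strips s) p ^+ sumn mu * vdm m mu.
Proof.
move=> ss szs; rewrite /vdm; set M := \matrix_(i, k) _.
pose U : 'M[A]_m.+1 := \matrix_(i, j) ((i == j)%:R - (j == i.+1 :> nat)%:R).
have detU : \det U = 1.
  rewrite -det_tr det_trig; last first.
    apply/is_trig_mxP => i j ij; rewrite !mxE.
    by rewrite -val_eqE (gtn_eqF ij) (ltn_eqF (ltnW ij : i < j.+1)%N) subr0.
  by rewrite big1 // => i _; rewrite !mxE eqxx (ltn_eqF (ltnSn i)) subr0.
have -> : \det M = \det (U *m M) by rewrite det_mulmx detU mul1r.
set B := U *m M.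
have Bmax k : B ord_max k = M ord_max k.
  rewrite mxE (bigD1 ord_max) //= big1 ?addr0 => [|j jm]; rewrite mxE.
    by rewrite eqxx (ltn_eqF (ltnSn _)) subr0 mul1r.
  by rewrite eq_sym (negbTE jm) (ltn_eqF (ltn_ord j)) subr0 mul0r.
have Blift (i : 'I_m) k : B (lift ord_max i) k = M (lift ord_max i) k - M (lift ord0 i) k.
  have nl : lift ord0 i != lift ord_max i.
    by rewrite -val_eqE /= /bump /= [(m <= i)%N]leqNgt ltn_ord /= add0n add1n gtn_eqF.
  rewrite mxE (bigD1 (lift ord_max i)) //= (bigD1 (lift ord0 i)) //=.
  rewrite big1 ?addr0 => [|j /andP[j1 j2]].
    rewrite !mxE eqxx [lift ord_max i == lift ord0 i]eq_sym (negbTE nl) /= /bump /= leqNgt ltn_ord /= add0n add1n eqxx.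
    by rewrite (ltn_eqF (ltnSn _)) subr0 sub0r mul1r mulN1r.
  have j3 : (val j == (lift ord_max i).+1) = false.
    apply/negbTE; apply: contra j2 => /eqP j2; rewrite -val_eqE /= j2 /= /bump /=.
    by rewrite leqNgt ltn_ord.
  by rewrite !mxE eq_sym (negbTE j1) j3 subr0 mul0r.
(* Column 0 of M is constantly 1, so the row differences vanish there and only the last row
   contributes; its cofactor gives the sign (-1)^m. *)
rewrite (expand_det_col B ord0) (bigD1 ord_max) //= big1 ?addr0; last first.
  move=> i; case: (unliftP ord_max i) => [j ->|->]; last by rewrite eqxx.
  by move=> _; rewrite Blift !mxE !mul0n subrr mul0r.
rewrite Bmax mxE mul0n expr0 mul1r /cofactor addn0 -!mulrA; congr (_ * _).
pose G : 'M[A]_m := \matrix_(i, k)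
  \sum_(nth 0%N s i.+1 <= z < (nth 0%N s i).+1) p ^+ (k.+1 * (z + (m.-1 - i))).
have rcB : row' ord_max (col' ord0 B) = G *m diag_mx (\row_k (p ^+ k.+1 - 1)) :> 'M[A]_m.
  apply/matrixP => i k; transitivity (B (lift ord_max i) (lift ord0 k)).
    by rewrite [LHS]mxE [LHS]mxE.
  rewrite Blift mul_mx_diag !mxE /= /bump /=.
  have im := ltn_ord i; rewrite leqNgt im /= !add0n !add1n.
  (* The staircase drops by one between rows i and i + 1. Without the common m - 1 - i the two
     exponents are s_i + 1 and s_{i+1}, the ends of the range of summation. *)
  have -> : (nth 0 s i + (m - i) = (nth 0 s i).+1 + (m.-1 - i))%N by lia.
  have -> : (m - i.+1 = m.-1 - i)%N by lia.
  rewrite !exprM geom_sum ?leqW ?sorted_geq_nthS // mulrC; congr (_ * _).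
  by apply: eq_bigr => z _; rewrite exprM.
transitivity (\det (G *m diag_mx (\row_k (p ^+ k.+1 - 1)))); first by rewrite -rcB.
rewrite det_mulmx det_diag mulrC; congr (_ * _); first by apply: eq_bigr => k _; rewrite mxE.
have -> : \det G = \sum_(mu <- strips s) \det (\matrix_(i < m, k < m)
    p ^+ (k.+1 * (nth 0%N mu i + (m.-1 - i)))).
  rewrite /determinant exchange_big /=; apply: eq_bigr => sg _.
  rewrite -big_distrr /=; congr (_ * _).
  (* The permutation acts on ordinals while the factors are indexed by naturals; [insub] bridges the
     two, and its default 0 is never reached. *)
  have := sum_strips_prod s (fun i z =>
    p ^+ ((if (insub i : option 'I_m) is Some i' then sg i' : nat else 0%N).+1 *
          (z + (m.-1 - i)))).
  rewrite szs -size_eq0 szs /= => /(_ isT) h.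
  transitivity (\prod_(j < m) \sum_(nth 0%N s j.+1 <= z < (nth 0%N s j).+1)
    p ^+ ((if (insub (val j) : option 'I_m) is Some i' then sg i' : nat else 0%N).+1 *
          (z + (m.-1 - j)))).
    by apply: eq_bigr => i _; rewrite mxE valK.
  rewrite -h; apply: eq_bigr => mu _; apply: eq_bigr => i _.
  by rewrite valK mxE.
rewrite big_distrr /= big_seq [RHS]big_seq; apply: eq_bigr => mu hmu.
have s0 : s != [::] by rewrite -size_eq0 szs.
have [zmu _] := mem_strips _ _ s0 hmu; rewrite szs /= in zmu.
rewrite mulrA -exprD sumnE (big_nth 0%N) zmu big_mkord addnC -big_split /=.
rewrite -prodrXr.
(* The columns have exponents k + 1. Pulling p^(mu_i + m - 1 - i) out of each row lowers them to k
   and produces p^|mu| together with the staircase power. *)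
transitivity (\det (diag_mx (\row_i p ^+ (nth 0%N mu i + (m.-1 - i))) *m
  (\matrix_(i < m, k < m) p ^+ (k * (nth 0%N mu i + (m.-1 - i)))))).
  congr (\det _); apply/matrixP => i k; rewrite mul_diag_mx !mxE.
  by rewrite mulSn exprD.
by rewrite det_mulmx det_diag; congr (_ * _); apply: eq_bigr => i _; rewrite mxE.
Qed.

(** The two recursions differ by a factor depending on m and p only, so the two functions of s are
    proportional. K is left implicit and is eliminated by comparison with s = 0. *)
Lemma vdm_corank_gf m : exists K : A, forall s, sorted geq s -> size s = m ->
  vdm m s = K * corank_gf m s.
Proof.
elim: m => [|m [K IH]].
  exists 1 => s _ _; rewrite /vdm det_mx00 mul1r /corank_gf /= big_seq1.
  by rewrite /corank big_nil.
exists ((-1) ^+ m * \prod_(k < m) (p ^+ k.+1 - 1) *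
  p ^+ (\sum_(i < m) (m.-1 - i)) * K) => s ss szs.
have s0 : s != [::] by rewrite -size_eq0 szs.
rewrite vdmS // corank_gfS // -[RHS]mulrA; congr (_ * _).
rewrite big_distrr /= big_seq [RHS]big_seq; apply: eq_bigr => mu hmu.
have smu := strips_sorted _ _ ss s0 hmu.
have [zmu _] := mem_strips _ _ s0 hmu; rewrite szs in zmu.
by rewrite IH // mulrCA.
Qed.

Lemma corank_gf0 m : corank_gf m (nseq m 0%N) = 1.
Proof.
elim: m => [|m IH]; first by rewrite /corank_gf /= big_seq1 /corank big_nil.
have sn : sorted geq (nseq m.+1 0%N) by elim: m {IH} => //= m ->.
rewrite corank_gfS ?size_nseq // (_ : strips _ = [:: nseq m 0%N]).
  by rewrite big_seq1 IH mulr1 sumn_nseq mul0n.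
by elim: m {IH sn} => //= m ->.
Qed.

(** At a principal specialization the exponents are products k (s_i + m - 1 - i), so the alternant
    is also a Vandermonde determinant in the nodes p^(s_i + m - 1 - i). *)
Lemma vdmE m s : vdm m s = \prod_(i < m) \prod_(j < m | (i < j)%N)
  (p ^+ (nth 0%N s j + (m.-1 - j)) - p ^+ (nth 0%N s i + (m.-1 - i))).
Proof.
rewrite /vdm -det_tr (_ : _^T = Vandermonde m
  (\row_j p ^+ (nth 0%N s j + (m.-1 - j)))).
  by rewrite det_Vandermonde; apply: eq_bigr => i _; apply: eq_bigr => j _; rewrite !mxE.
by apply/matrixP => i j; rewrite !mxE mulnC exprM.
Qed.

(** Stated without division, over any commutative ring, since the alternant of the empty partition
    may be a zero divisor. *)
Lemma corank_gf_vdm m s : sorted geq s -> size s = m ->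
  vdm m (nseq m 0%N) * corank_gf m s = vdm m s.
Proof.
move=> ss szs; have [K hK] := vdm_corank_gf m.
rewrite [in RHS]hK // (hK (nseq m 0%N)) ?size_nseq //; last by elim: m {szs hK} => // -[|m] //=.
by rewrite corank_gf0 mulr1.
Qed.

End PrincipalSpecialization.

(** * Fillings of the diagram as lists of rows *)

Section Encoding.
Variables (lam : seq nat) (m : nat).
Hypothesis lamP : is_partition lam.
Hypothesis lam_le : (size lam <= m)%N.
Implicit Types (f g : filling lam m) (c : cell lam).

Definition pad : seq nat := lam ++ nseq (m - size lam) 0%N.

Lemma nth_pad i : nth 0%N pad i = nth 0%N lam i.
Proof.
rewrite nth_cat; case: ltnP => // h.
by rewrite nth_nseq if_same nth_default.
Qed.

Lemma size_pad : size pad = m.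
Proof. by rewrite size_cat size_nseq subnKC. Qed.

Lemma lam_sorted : sorted geq lam. Proof. by case/andP: lamP. Qed.

Lemma pad_sorted : sorted geq pad.
Proof.
apply/(sortedP 0%N) => i _; rewrite !nth_pad; exact/sorted_geq_nthS/lam_sorted.
Qed.

Lemma cell_inj c c' : row_of c = row_of c' -> col_of c = col_of c' -> c = c'.
Proof.
case: c => i j; case: c' => i' j'; rewrite /row_of /col_of /= => /val_inj ii.
by subst i' => /val_inj ->.
Qed.

Lemma cell_ex i j : (j < nth 0%N lam i)%N ->
  exists c, row_of c = i /\ col_of c = j.
Proof.
move=> hj; have hi : (i < size lam)%N.
  by case: ltnP => // h; rewrite nth_default in hj.
by exists (existT (fun i : 'I_(size lam) => 'I_(nth 0%N lam i))
  (Ordinal hi) (Ordinal hj)).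
Qed.

Lemma row_lt c : (row_of c < m)%N.
Proof. exact: leq_trans (ltn_ord (tag c)) lam_le. Qed.

Lemma col_lt c : (col_of c < nth 0%N lam (row_of c))%N.
Proof. exact: (ltn_ord (tagged c)). Qed.

(** A sum with at most one term, which makes the lookup total: it is 0 outside the diagram. *)
Definition entry f i j : nat :=
  (\sum_(c | (row_of c == i) && (col_of c == j)) f c)%N.

Lemma entryE f c : entry f (row_of c) (col_of c) = f c.
Proof.
rewrite /entry (big_pred1 c) // => c' /=; apply/andP/eqP => [[/eqP h1 /eqP h2]|->//].
exact: cell_inj.
Qed.

Definition rows f : seq (seq nat) :=
  [seq [seq entry f i j | j <- iota 0 (nth 0%N lam i)] | i <- iota 0 m].

Lemma nth_rows f i : (i < m)%N ->
  nth [::] (rows f) i = [seq entry f i j | j <- iota 0 (nth 0%N lam i)].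
Proof. by move=> h; rewrite (nth_map 0%N) ?size_iota // nth_iota. Qed.

Lemma nth_rows_cell f c :
  nth 0%N (nth [::] (rows f) (row_of c)) (col_of c) = f c.
Proof.
rewrite nth_rows ?row_lt // (nth_map 0%N) ?size_iota ?col_lt //.
by rewrite nth_iota ?col_lt // entryE.
Qed.

Lemma ssyt_row f c c' : is_ssyt f -> row_of c = row_of c' ->
  (col_of c < col_of c')%N -> (f c <= f c')%N.
Proof.
move=> /forallP/(_ c)/forallP/(_ c')/andP[h _] hr hc.
by move: h; rewrite hr eqxx hc.
Qed.

Lemma ssyt_col f c c' : is_ssyt f -> col_of c = col_of c' ->
  (row_of c < row_of c')%N -> (f c < f c')%N.
Proof.
move=> /forallP/(_ c)/forallP/(_ c')/andP[_ h] hr hc.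
by move: h; rewrite hr eqxx hc.
Qed.

(** Above a cell of row i there are i strictly smaller entries in its column. The bound is part of
    [is_tab] because it forces the last row of a tableau to consist of the largest letter. *)
Lemma ssyt_ge f i c : is_ssyt f -> row_of c = i -> (i <= f c)%N.
Proof.
move=> hf; elim: i c => [//|i IH] c hi.
have : (col_of c < nth 0%N lam i)%N.
  by apply: leq_trans (col_lt c) _; rewrite hi sorted_geq_nthS // lam_sorted.
case/cell_ex => c' [r' c'c]; apply: leq_ltn_trans (IH c' r') _.
by apply: ssyt_col => //; rewrite r' hi.
Qed.

Lemma rows_tab f : is_ssyt f -> is_tab m pad (rows f).
Proof.
move=> hf.
have szr i : (i < m)%N -> size (nth [::] (rows f) i) = nth 0%N lam i.
  by move=> im; rewrite nth_rows // size_map size_iota.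
have szsh : size (shape (rows f)) = m by rewrite /shape !size_map size_iota.
split.
- by rewrite size_map size_iota.
- apply: (@eq_from_nth _ 0%N); first by rewrite szsh size_pad.
  by move=> i; rewrite szsh => im; rewrite nth_shape szr // nth_pad.
- move=> i im; apply/(sortedP 0%N) => j; rewrite szr // => hj.
  have [c [ri cj]] := cell_ex i j (ltnW hj).
  have [c' [ri' cj']] := cell_ex i j.+1 hj.
  rewrite -[X in nth [::] _ X]ri -[X in nth 0%N _ X]cj nth_rows_cell.
  rewrite ri -[X in nth [::] _ X]ri' -[X in nth 0%N _ X]cj' nth_rows_cell.
  by apply: ssyt_row => //; [rewrite ri'|rewrite cj cj'].
- move=> i x im; rewrite nth_rows // => /mapP[j]; rewrite mem_iota add0n => hj ->.
  have [c [<- <-]] := cell_ex i j hj.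
  by rewrite entryE ltn_ord ssyt_ge.
- move=> i j im; rewrite szr // => hj.
  have [c' [ri' cj']] := cell_ex _ _ hj.
  have [|c [ri cj]] := cell_ex i j.
    by apply: leq_trans hj _; rewrite sorted_geq_nthS // lam_sorted.
  rewrite -{1}ri -{1}cj nth_rows_cell -ri' -cj' nth_rows_cell.
  by apply: ssyt_col => //; [rewrite cj|rewrite ri ri'].
Qed.

Lemma rows_inj : injective rows.
Proof.
move=> f g fg; apply/ffunP => c; apply: val_inj => /=.
by rewrite -!nth_rows_cell fg.
Qed.

Lemma rows_surj t : is_tab m pad t -> exists2 f, is_ssyt f & rows f = t.
Proof.
move=> [szt sh srt ent col].
have szti i : size (nth [::] t i) = nth 0%N lam i by rewrite -nth_shape sh nth_pad.
have cl c : (nth 0%N (nth [::] t (row_of c)) (col_of c) < m)%N.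
  have := ent (row_of c) (nth 0%N (nth [::] t (row_of c)) (col_of c)) (row_lt c).
  by rewrite mem_nth ?szti ?col_lt // => /(_ isT)/andP[].
pose f : filling lam m := [ffun c => Ordinal (cl c)].
have fE c : f c = nth 0%N (nth [::] t (row_of c)) (col_of c) :> nat by rewrite ffunE.
(* [is_tab] compares adjacent rows only, whereas [is_ssyt] compares any two rows of a column. *)
have colD i k j : (i + k.+1 < m)%N -> (j < nth 0%N lam (i + k.+1))%N ->
    (nth 0%N (nth [::] t i) j < nth 0%N (nth [::] t (i + k.+1)) j)%N.
  elim: k => [|k IH]; first by rewrite addn1 => h1 h2; apply: col; rewrite ?szti.
  rewrite [(i + k.+2)%N]addnS => h1 h2.
  have h3 : (j < nth 0%N lam (i + k.+1))%N.
    by apply: leq_trans h2 _; rewrite sorted_geq_nthS // lam_sorted.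
  by apply: ltn_trans (IH (ltnW h1) h3) (col _ _ h1 _); rewrite szti.
exists f.
  apply/forallP => c; apply/forallP => c'; apply/andP; split.
    apply/implyP => /andP[/eqP hr hc]; rewrite !fE -hr.
    have := srt _ (row_lt c); rewrite sorted_pairwise; last exact: leq_trans.
    move/(pairwiseP 0%N); apply; rewrite ?inE ?szti ?col_lt //.
    by rewrite hr col_lt.
  apply/implyP => /andP[/eqP hc hr]; rewrite !fE hc.
  have e : (row_of c + (row_of c' - row_of c).-1.+1)%N = row_of c' by lia.
  by rewrite -[in X in (_ < X)%N]e; apply: colD; rewrite e ?row_lt ?col_lt.
apply: (@eq_from_nth _ [::]); first by rewrite size_map size_iota.
move=> i; rewrite size_map size_iota => im; rewrite nth_rows //.
apply: (@eq_from_nth _ 0%N); first by rewrite size_map size_iota szti.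
move=> j; rewrite size_map size_iota => hj; rewrite (nth_map 0%N) ?size_iota //.
by rewrite nth_iota // add0n; have [c [<- <-]] := cell_ex i j hj; rewrite entryE fE.
Qed.

(** Each entry x contributes x to one statistic and m - 1 - x to the other. *)
Lemma rank_rows (T : ssyt lam m) :
  (rank T + corank m (rows (val T)) = m.-1 * sumn lam)%N.
Proof.
have -> : rank T = (\sum_(r <- rows (val T)) \sum_(x <- r) x)%N.
  transitivity (\sum_c (val T c : nat))%N.
    rewrite (partition_big (fun c => val T c) xpredT) //=.
    rewrite /rank; apply: eq_bigr => i _.
    rewrite (eq_bigr (fun=> i : nat)) => [|c /eqP->//].
    by rewrite sum_nat_const mulnC; congr (_ * _)%N; apply: eq_card.
  have iotaE k : iota 0 k = index_iota 0 k by rewrite /index_iota subn0.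
  rewrite /rows big_map iotaE big_mkord.
  rewrite (big_ord_widen_cond m xpredT (fun i => \sum_(x <- [seq entry (val T) i j | j <- iota 0 (nth 0 lam i)]) x)%N (leqnn _)).
  rewrite [RHS](bigID (fun i : 'I_m => i < size lam)%N) /= [X in (_ + X)%N]big1 ?addn0; last first.
    by move=> i /andP[_]; rewrite -leqNgt => h; rewrite nth_default // big_nil.
  rewrite (eq_bigl (fun i : 'I_m => (i < size lam)%N)) => [|i]; last by rewrite ltn_ord.
  rewrite -(big_ord_widen_cond m xpredT (fun i => \sum_(x <- [seq entry (val T) i j | j <- iota 0 (nth 0 lam i)]) x)%N lam_le).
  rewrite [RHS](eq_bigr (fun i : 'I_(size lam) => \sum_(j < nth 0%N lam i)
     (val T (existT (fun i : 'I_(size lam) => 'I_(nth 0%N lam i)) i j) : nat))%N); last first.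
    move=> i _; rewrite big_map iotaE big_mkord; apply: eq_bigr => j _.
    exact: (entryE (val T) (existT (fun i : 'I_(size lam) => 'I_(nth 0%N lam i)) i j)).
  by rewrite sig_big_dep /=; apply: eq_bigr => -[].
have := rows_tab _ (valP T); move: (rows _) => t [szt sh _ ent _].
rewrite /corank -big_split /=.
have -> : sumn lam = sumn pad by rewrite sumn_cat sumn_nseq mul0n addn0.
rewrite -sh sumnE big_map big_distrr /= !(big_nth [::]) szt.
rewrite big_nat [RHS]big_nat; apply: eq_bigr => i im.
rewrite -big_split /= -sum1_size big_distrr /= big_seq [RHS]big_seq.
by apply: eq_bigr => x /(ent _ _ im); lia.
Qed.

Lemma sum_ssyt (V : nmodType) (F : nat -> V) :
  \sum_(T : ssyt lam m) F (corank m (rows (val T))) =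
  \sum_(t <- tabs m pad) F (corank m t).
Proof.
rewrite -(big_map (fun T : ssyt lam m => rows (val T)) xpredT (fun t => F (corank m t))).
apply: perm_big; apply: uniq_perm.
- rewrite map_inj_uniq; first exact: index_enum_uniq.
  by move=> T T' /rows_inj/val_inj.
- by apply: tabs_uniq; [exact: pad_sorted|exact: size_pad].
move=> t; apply/mapP/(mem_tabs _ _ _ pad_sorted size_pad) => [[T _ ->]|].
  by apply: rows_tab; exact: (valP T).
case/rows_surj => f hf <-; exists (exist _ f hf) => //.
Qed.

End Encoding.

(** * The product of q-integer ratios *)

Section ProductFormula.
Variable R : realType.

(** Difference of the shifted parts s_i - i and s_j - j. For sorted s and i <= j the truncated
    subtractions are exact. *)
Definition hook (s : seq nat) (i j : nat) : nat :=
  (nth 0%N s i - nth 0%N s j + (j - i))%N.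

Lemma sorted_geq_nth s i j : sorted geq s -> (i <= j)%N ->
  (nth 0%N s j <= nth 0%N s i)%N.
Proof.
move=> ss ij; rewrite -(subnKC ij); elim: (j - i)%N => [|k IH]; first by rewrite addn0.
by rewrite addnS (leq_trans _ IH) // sorted_geq_nthS.
Qed.

Lemma corank_gfE m s : sorted geq s -> size s = m -> forall q : R,
  corank_gf R q m s * \prod_(i < m) \prod_(j < m | (i < j)%N)
     (q ^+ (m.-1 - j) * qint R (j - i) q) =
  \prod_(i < m) \prod_(j < m | (i < j)%N)
     (q ^+ (nth 0%N s j + (m.-1 - j)) * qint R (hook s i j) q).
Proof.
move=> ss szs q.
(* Over polynomials the factors 1 - X are nonzero and can be cancelled; only then is X evaluated at
   q, with q = 1 allowed. *)
pose Q n : {poly R} := \sum_(k < n) 'X^k.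
have QE n : (Q n).[q] = qint R n q.
  by rewrite /Q horner_sum; apply: eq_bigr => k _; rewrite hornerXn.
have fac (u : seq nat) : sorted geq u -> vdm _ 'X m u =
    (\prod_(i < m) \prod_(j < m | (i < j)%N) (1 - 'X : {poly R})) *
    \prod_(i < m) \prod_(j < m | (i < j)%N)
     ('X^(nth 0%N u j + (m.-1 - j)) * Q (hook u i j)).
  move=> su; rewrite vdmE -big_split /=; apply: eq_bigr => i _.
  rewrite -big_split /=; apply: eq_bigr => j ij.
  have := sorted_geq_nth u i j su (ltnW ij); have := ltn_ord j => jm uij.
  have -> : (nth 0 u i + (m.-1 - i) = (nth 0 u j + (m.-1 - j)) + hook u i j)%N.
    by rewrite /hook; lia.
  move: (_ + _)%N (hook _ _ _) => a h.
  transitivity ('X^a * (1 - 'X^h) : {poly R}); first by rewrite exprD mulrBr mulr1.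
  rewrite [RHS]mulrCA; congr (_ * _).
  by rewrite -[LHS]opprB subrX1 -mulNr opprB.
have X1 : (1 - 'X : {poly R}) != 0.
  by rewrite -opprB oppr_eq0 polyXsubC_eq0.
have := corank_gf_vdm _ ('X : {poly R}) m s ss szs.
have sn : sorted geq (nseq m 0%N).
  by apply/(sortedP 0%N) => i _ /=; rewrite !nth_nseq !if_same.
rewrite !fac // -mulrA => /mulfI h.
have {h}/(congr1 (fun P => P.[q])) := h (introT (prodf_neq0 _ _) (fun i _ =>
  introT (prodf_neq0 _ _) (fun j _ => X1))).
rewrite !hornerE /corank_gf horner_sum /= => h.
rewrite mulrC (eq_bigr (fun t => ('X^(corank m t)).[q])); last by move=> t _; rewrite hornerXn.
move: h; rewrite !horner_prod => h.
transitivity ((\prod_(i < m) (\prod_(j < m | (i < j)%N) ('X^(nth 0%N (nseq m 0%N) j + (m.-1 - j)) *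
            Q (hook (nseq m 0%N) i j))).[q]) * \sum_(i <- tabs m s) 'X^(corank m i).[q]).
  congr (_ * _); apply: eq_bigr => i _; rewrite horner_prod; apply: eq_bigr => j _.
  by rewrite hornerM hornerXn QE /hook !nth_nseq !if_same subnn !add0n.
rewrite h; apply: eq_bigr => i _; rewrite horner_prod; apply: eq_bigr => j _.
by rewrite hornerM hornerXn QE.
Qed.

End ProductFormula.

(** * Cumulants and moments of uniform variables *)

Section UniformCumulants.
Variables (R : realType) (Omega : finType).
Hypothesis Omega0 : (0 < #|Omega|)%N.
Implicit Types X : Omega -> R.

Lemma cardR_gt0 : 0 < #|Omega|%:R :> R. Proof. by rewrite ltr0n. Qed.

Lemma uexp_sum X : uexp X = #|Omega|%:R^-1 * \sum_w X w.
Proof. by rewrite /uexp mulrC. Qed.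

Lemma uexpD X Y : uexp (fun w => X w + Y w) = uexp X + uexp Y.
Proof. by rewrite /uexp big_split mulrDl. Qed.

Lemma uexpZ a X : uexp (fun w => a * X w) = a * uexp X.
Proof. by rewrite /uexp -big_distrr mulrA. Qed.

Lemma uexp_cst (a : R) : uexp (fun _ : Omega => a) = a.
Proof.
rewrite /uexp (_ : \sum_w a = a * #|Omega|%:R); last by rewrite sumr_const mulr_natr.
by rewrite mulfK // lt0r_neq0 // cardR_gt0.
Qed.

Lemma umgfE X t : umgf X t = #|Omega|%:R^-1 * \sum_w expR (X w * t).
Proof. by rewrite /umgf uexp_sum; under eq_bigr do rewrite mulrC. Qed.

Lemma umgf_gt0 X t : 0 < umgf X t.
Proof.
rewrite umgfE mulr_gt0 ?invr_gt0 ?cardR_gt0 //.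
case/card_gt0P: Omega0 => w _; rewrite (bigD1 w) //= ltr_wpDr ?expR_gt0 //.
by apply: sumr_ge0 => i _; exact: expR_ge0.
Qed.

Lemma nderivable_umgf n X : nderivable R n (umgf X).
Proof.
rewrite (_ : umgf X = fun t => #|Omega|%:R^-1 * \sum_w expR (X w * t)).
  apply: nderivableM; first exact: nderivable_cst.
  by apply: nderivable_sum => i _; exact: nderivable_expM.
by apply/funext => t; exact: umgfE.
Qed.

Lemma derive1n_umgf n X : derive1n n (umgf X) 0 = uexp (fun w => X w ^+ n).
Proof.
rewrite (_ : umgf X = fun t => #|Omega|%:R^-1 * \sum_w expR (X w * t)).
  rewrite derive1nZ; last by apply: nderivable_sum => i _; exact: nderivable_expM.
  rewrite derive1n_sum; last by move=> i _; exact: nderivable_expM.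
  rewrite uexp_sum; congr (_ * _); apply: eq_bigr => w _.
  by rewrite derive1n_expM mulr0 expR0 mulr1.
by apply/funext => t; exact: umgfE.
Qed.

(* Leibniz' rule applied to M' = K' M, where K = ln M. *)
Lemma moment_cumulant n X : uexp (fun w => X w ^+ n.+1) =
  \sum_(i < n.+1) 'C(n, i)%:R * ucumulant i.+1 X * uexp (fun w => X w ^+ (n - i)).
Proof.
rewrite -derive1n_umgf derive1Sn.
have [hM sM] : nderivable R n.+1 (umgf X) := nderivable_umgf n.+1 X.
have sK k : nderivable R k (fun t => ln (umgf X t)).
  by apply: nderivable_ln; [exact: umgf_gt0|exact: nderivable_umgf].
have [hK sK'] := sK n.+1.
rewrite (_ : derive1 (umgf X) = fun t => derive1 (fun t => ln (umgf X t)) t * umgf X t).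
  rewrite derive1nM //; last exact: nderivable_umgf.
  by apply: eq_bigr => i _; rewrite derive1n_umgf -derive1Sn.
rewrite (derive1_has_derivative _ _ _ (has_derivative_ln _ _ _ (umgf_gt0 X) hM)).
by apply/funext => t; rewrite divfK // lt0r_neq0 // umgf_gt0.
Qed.

Lemma ucumulant1 X : ucumulant 1 X = uexp X.
Proof.
have := moment_cumulant 0 X; rewrite big_ord1 /= bin0 mul1r.
rewrite (_ : (fun w => X w ^+ (0 - 0)) = fun=> 1) // uexp_cst mulr1 => <-.
by congr uexp; apply/funext => w; rewrite expr1.
Qed.

Lemma ucumulant2 X : ucumulant 2 X = uvar X.
Proof.
have := moment_cumulant 1 X; rewrite big_ord_recl big_ord1 /= /bump /= bin0 bin1 !mul1r.
rewrite ucumulant1 subn0 subnn addn0.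
rewrite (_ : (fun w => X w ^+ 1) = X); last by apply/funext => w; rewrite expr1.
rewrite (_ : (fun w => X w ^+ 0) = fun=> 1) ?uexp_cst ?mulr1 => [h|//].
rewrite /uvar (_ : (fun w => _) = fun w => (X w ^+ 2 + - (2 * uexp X) * X w) + uexp X ^+ 2).
  by rewrite 2!uexpD uexp_cst uexpZ h; ring.
by apply/funext => w; ring.
Qed.

(** The translation adds the linear term b t to the logarithm of the moment generating function, and
    two derivatives kill it. *)
Lemma ucumulant_affine d (a b : R) X : (2 <= d)%N ->
  ucumulant d (fun w => a * X w + b) = a ^+ d * ucumulant d X.
Proof.
case: d => [|[|d]] // _; rewrite /ucumulant.
rewrite (_ : (fun t => ln (umgf (fun w => a * X w + b) t)) =
  fun t => ln (umgf X (a * t)) + b * t).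
  have sK k : nderivable R k (fun t => ln (umgf X t)).
    by apply: nderivable_ln; [exact: umgf_gt0|exact: nderivable_umgf].
  rewrite derive1nD.
  - rewrite derive1n_linear addr0.
    by rewrite (derive1n_scale _ _ (fun t => ln (umgf X t))) ?mulr0.
  - exact: (nderivable_scale _ _ (fun t => ln (umgf X t))).
  - by apply: nderivableM; [exact: nderivable_cst|exact: nderivable_id].
apply/funext => t; rewrite -[X in _ + X]expRK -lnM ?posrE ?expR_gt0 ?umgf_gt0 //.
congr ln; rewrite !umgfE -mulrA; congr (_ * _).
rewrite big_distrl /=; apply: eq_bigr => w _; rewrite -expRD; congr expR; ring.
Qed.

End UniformCumulants.

(** * Cumulants of the rank *)

Section RankCumulants.
Variable R : realType.
Variables (lam : seq nat) (m : nat).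
Hypothesis lamP : is_partition lam.
Hypothesis lam_le : (size lam <= m)%N.

Definition hook_sum (d : nat) : R :=
  \sum_(i < m) \sum_(j < m | (i < j)%N)
    ((hook (pad lam m) i j)%:R ^+ d - (j - i)%:R ^+ d).

Let corank_rank (T : ssyt lam m) q : 0 < q ->
  q ^+ (rank T) = q ^+ (m.-1 * sumn lam) * q^-1 ^+ corank m (rows _ _ (val T)) :> R.
Proof.
move=> q0; rewrite -(rank_rows lam m lamP lam_le T) exprD -mulrA -exprMn divff ?lt0r_neq0 //.
by rewrite expr1n mulr1.
Qed.

Let sum_rank t : \sum_(T : ssyt lam m) expR (rank_var R lam m T * t) =
  expR t ^+ (m.-1 * sumn lam) * corank_gf R (expR (- t)) m (pad lam m).
Proof.
rewrite /corank_gf -(sum_ssyt lam m lamP lam_le _ (fun k => expR (- t) ^+ k)) big_distrr /=.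
by apply: eq_bigr => T _; rewrite expRM_natl corank_rank ?expR_gt0 // expRN.
Qed.

Let q_gt0 t : 0 < expR (- t) :> R. Proof. exact: expR_gt0. Qed.

Let hook_gt0 (i j : 'I_m) : (i < j)%N -> (0 < hook (pad lam m) i j)%N.
Proof. by rewrite /hook; lia. Qed.

Lemma corank_gf_gt0 t : 0 < corank_gf R (expR (- t)) m (pad lam m).
Proof.
have := corank_gfE R m (pad lam m) (pad_sorted _ _ lamP) (size_pad _ _ lam_le) (expR (- t)).
set P := \prod_(i < m) _; set Q := \prod_(i < m) _ => h.
have P0 : 0 < P.
  apply: prodr_gt0 => i _; apply: prodr_gt0 => j ij.
  by rewrite mulr_gt0 ?exprn_gt0 ?qint_gt0 // subn_gt0.
have Q0 : 0 < Q.
  apply: prodr_gt0 => i _; apply: prodr_gt0 => j ij.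
  by rewrite mulr_gt0 ?exprn_gt0 ?qint_gt0 ?hook_gt0.
by rewrite -(pmulr_lgt0 _ P0) h.
Qed.

(** At t = 0 the generating function counts the tableaux, and the product formula shows that it is
    positive; no tableau has to be exhibited. *)
Lemma ssyt_gt0 : (0 < #|{: ssyt lam m}|)%N.
Proof.
rewrite -(ltr0n R) -sumr_const.
have := sum_rank 0; rewrite expR0 expr1n mul1r => h.
rewrite (_ : \sum_(i in _) 1 = corank_gf R (expR (- 0)) m (pad lam m)).
  exact: corank_gf_gt0.
by rewrite -h; apply: eq_bigr => T _; rewrite mulr0 expR0.
Qed.

Let ln_term t (a n : nat) : (0 < n)%N ->
  ln (expR (- t) ^+ a * qint R n (expR (- t))) = - a%:R * t + log_qint R n (-1 * t).
Proof.
move=> n0; rewrite lnM ?posrE ?exprn_gt0 ?qint_gt0 // -expRM_natl expRK mulN1r.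
by rewrite mulrN mulNr.
Qed.

(** Passing from rank to corank replaces q by its inverse, hence the arguments -t. All pure powers
    of q are collected in a t, which is invisible to cumulants of order at least 2. *)
Lemma log_umgf_rank : exists c a : R, forall t,
  ln (umgf (rank_var R lam m) t) = c + (a * t +
    \sum_(i < m) \sum_(j < m | (i < j)%N)
      (log_qint R (hook (pad lam m) i j) (-1 * t) + -1 * log_qint R (j - i) (-1 * t))).
Proof.
pose a1 : R := \sum_(i < m) \sum_(j < m | (i < j)%N) - (m.-1 - j)%:R.
pose a2 : R := \sum_(i < m) \sum_(j < m | (i < j)%N)
   - (nth 0%N (pad lam m) j + (m.-1 - j))%:R.
exists (ln (#|{: ssyt lam m}|%:R^-1)), ((m.-1 * sumn lam)%:R + (a2 - a1)) => t.
rewrite umgfE sum_rank.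
have n0 : 0 < #|{: ssyt lam m}|%:R^-1 :> R by rewrite invr_gt0 ltr0n ssyt_gt0.
have C0 := corank_gf_gt0 t.
rewrite !lnM ?posrE ?mulr_gt0 ?exprn_gt0 ?expR_gt0 //; congr (_ + _).
rewrite mulrDl -addrA -expRM_natl expRK; congr (_ + _).
have := corank_gfE R m (pad lam m) (pad_sorted _ _ lamP) (size_pad _ _ lam_le) (expR (- t)).
move/(congr1 (@ln R)).
have pos (i j : 'I_m) a n : (0 < n)%N -> 0 < expR (- t) ^+ a * qint R n (expR (- t)).
  by move=> n0'; rewrite mulr_gt0 ?exprn_gt0 ?qint_gt0.
rewrite lnM ?posrE //; last first.
  by apply: prodr_gt0 => i _; apply: prodr_gt0 => j ij; rewrite (pos i j) // subn_gt0.
rewrite !ln_prod; last first.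
- by move=> i _; apply: prodr_gt0 => j ij; rewrite (pos i j) // subn_gt0.
- by move=> i _; apply: prodr_gt0 => j ij; rewrite (pos i j) // hook_gt0.
rewrite (eq_bigr (fun i : 'I_m => \sum_(j < m | (i < j)%N) - (m.-1 - j)%:R * t +
    \sum_(j < m | (i < j)%N) log_qint R (j - i) (-1 * t))); last first.
  move=> i _; rewrite ln_prod; last by move=> j ij; rewrite (pos i j) // subn_gt0.
  by rewrite -big_split; apply: eq_bigr => j ij; rewrite ln_term // subn_gt0.
rewrite [in RHS](eq_bigr (fun i : 'I_m => \sum_(j < m | (i < j)%N) - (nth 0%N (pad lam m) j + (m.-1 - j))%:R * t +
    \sum_(j < m | (i < j)%N) log_qint R (hook (pad lam m) i j) (-1 * t))); last first.
  move=> i _; rewrite ln_prod; last by move=> j ij; rewrite (pos i j) // hook_gt0.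
  by rewrite -big_split; apply: eq_bigr => j ij; rewrite ln_term // hook_gt0.
rewrite !big_split /= => h.
rewrite [in RHS](eq_bigr (fun i : 'I_m => \sum_(j < m | (i < j)%N) log_qint R (hook (pad lam m) i j) (-1 * t)
   + - \sum_(j < m | (i < j)%N) log_qint R (j - i) (-1 * t))); last first.
  move=> i _; rewrite big_split /= -sumrN; congr (_ + _).
  by apply: eq_bigr => j _; rewrite mulN1r.
have dist (F : 'I_m -> 'I_m -> R) : (\sum_(i < m) \sum_(j < m | (i < j)%N) F i j) * t =
    \sum_(i < m) \sum_(j < m | (i < j)%N) F i j * t.
  by rewrite mulr_suml; apply: eq_bigr => i _; rewrite mulr_suml.
rewrite big_split /= sumrN mulrBl /a1 /a2 !dist.
by lra.
Qed.

(** Both q-integers of a pair contribute c (n^d - 1) with the same c, so the two subtracted ones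
    cancel. The sign (-1)^d comes from the arguments -t. *)
Lemma ucumulant_rank d : (2 <= d)%N -> ucumulant d (rank_var R lam m) =
  (-1) ^+ d * (qint_cumulant R d 2 / (2 ^+ d - 1)) * hook_sum d.
Proof.
case: d => [|[|d]] // _; have [c [a h]] := log_umgf_rank.
rewrite /ucumulant (funext h).
pose G (i j : 'I_m) (t : R) := log_qint R (hook (pad lam m) i j) (-1 * t) +
  -1 * log_qint R (j - i) (-1 * t).
pose S (t : R) := \sum_(i < m) \sum_(j < m | (i < j)%N) G i j t.
have sq n : (0 < n)%N -> nderivable R d.+2 (fun t => log_qint R n (-1 * t)).
  by move=> n0; apply: nderivable_scale; exact: nderivable_log_qint.
have sqN n : (0 < n)%N -> nderivable R d.+2 (fun t => -1 * log_qint R n (-1 * t)).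
  by move=> n0; apply: nderivableM; [exact: nderivable_cst|exact: sq].
have sG (i j : 'I_m) : (i < j)%N -> nderivable R d.+2 (G i j).
  by move=> ij; apply: nderivableD; [exact/sq/hook_gt0|apply: sqN; rewrite subn_gt0].
have sSi (i : 'I_m) : nderivable R d.+2 (fun t => \sum_(j < m | (i < j)%N) G i j t).
  by apply: nderivable_sum => j ij; exact: sG.
have sS : nderivable R d.+2 S by apply: nderivable_sum => i _; exact: sSi.
have sl : nderivable R d.+2 (fun t => a * t).
  by apply: nderivableM; [exact: nderivable_cst|exact: nderivable_id].
transitivity (derive1n d.+2 (fun t => c + (a * t + S t)) 0); first by [].
rewrite (derive1nD _ _ (fun=> c) (fun t => a * t + S t)); last first.
- by apply: nderivableD.
- exact: nderivable_cst.
rewrite derive1n_cst add0r (derive1nD _ _ (fun t => a * t) S) // derive1n_linear add0r.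
have -> : derive1n d.+2 S 0 =
    \sum_(i < m) \sum_(j < m | (i < j)%N) derive1n d.+2 (G i j) 0.
  transitivity (\sum_(i < m) derive1n d.+2 (fun t => \sum_(j < m | (i < j)%N) G i j t) 0).
    exact: (derive1n_sum R d.+2 'I_m (index_enum _) xpredT
      (fun i t => \sum_(j < m | (i < j)%N) G i j t) 0 (fun i _ => sSi i)).
  apply: eq_bigr => i _.
  exact: (derive1n_sum R d.+2 'I_m (index_enum _) (fun j => (i < j)%N) (G i) 0 (sG i)).
rewrite /hook_sum big_distrr; apply: eq_bigr => i _.
rewrite big_distrr; apply: eq_bigr => j ij.
have h0 := hook_gt0 i j ij; have d0 : (0 < j - i)%N by rewrite subn_gt0.
rewrite /G (derive1nD _ _ (fun t => log_qint R (hook (pad lam m) i j) (-1 * t))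
  (fun t => -1 * log_qint R (j - i) (-1 * t))); [|exact: sq|exact: sqN].
rewrite (derive1nZ _ _ (fun t => log_qint R (j - i) (-1 * t))); last exact: sq.
rewrite (derive1n_scale _ _ (log_qint R (hook _ i j))); last exact: nderivable_log_qint.
rewrite (derive1n_scale _ _ (log_qint R (j - i))); last exact: nderivable_log_qint.
rewrite mulr0 -!/(qint_cumulant R _ _) (qint_cumulantE _ _ (hook _ _ _)) // (qint_cumulantE _ _ (j - i)%N) //.
rewrite [RHS]/=; move: (qint_cumulant R d.+2 2) => k; ring.
Qed.

End RankCumulants.

(** * Hook sums over blocks of equal parts *)

Section BlockSums.
Variable R : realType.

(** With x = D + y the difference is D times the sum of x^(p-i) y^i for i <= p. The term i = 0 alone
    gives the lower bound, and each of the p + 1 terms is at most x^p. *)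
Lemma expr_sub_bounds (p : nat) (y D : R) : 0 <= y -> 0 <= D ->
  D * (D + y) ^+ p <= (D + y) ^+ p.+1 - y ^+ p.+1 <= p.+1%:R * (D * (D + y) ^+ p).
Proof.
move=> y0 D0; rewrite subrXX addrK.
have x0 : 0 <= D + y by rewrite addr_ge0.
have t0 (i : 'I_p.+1) : 0 <= (D + y) ^+ (p.+1.-1 - i) * y ^+ i.
  by rewrite mulr_ge0 ?exprn_ge0.
apply/andP; split.
  apply: ler_wpM2l => //; rewrite big_ord_recl /= subn0 mulr1 lerDl.
  by apply: sumr_ge0 => i _; exact: (t0 (lift ord0 i)).
rewrite mulrCA; apply: ler_wpM2l => //.
rewrite [leRHS](_ : _ = \sum_(i < p.+1) (D + y) ^+ p); last first.
  by rewrite sumr_const card_ord mulr_natl.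
apply: ler_sum => i _ /=.
have ip : (i <= p)%N by rewrite -ltnS.
rewrite -[leRHS](_ : (D + y) ^+ (p - i) * (D + y) ^+ i = _); last by rewrite -exprD subnK.
by apply: ler_wpM2l; rewrite ?exprn_ge0 // lerXn2r ?nnegrE // lerDr.
Qed.

(** The distance j - i between the s-th index of block a and the u-th index of block b, where c is
    the total size of the blocks strictly in between. *)
Let yf (c : R) (ea s u : nat) : R := c + (ea%:R - s%:R) + u%:R.

(* The lower bound pairs (s, u) with its reflection (ea - 1 - s, eb - 1 - u):
   of the two hook lengths, one is at least half of the maximal one. *)
Lemma block_bounds (p ea eb : nat) (D c W : R) : 1 <= D -> 0 <= c ->
  W = D * ea%:R * eb%:R * (D - 1 + (c + ea%:R + eb%:R)) ^+ p ->
  W / 2 ^+ p.+1 <=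
    \sum_(s < ea) \sum_(u < eb) ((D + yf c ea s u) ^+ p.+1 - yf c ea s u ^+ p.+1)
  <= p.+1%:R * W.
Proof.
move=> D1 c0 WE.
have D0 : 0 <= D by lra.
have y0 (s : 'I_ea) (u : 'I_eb) : 0 <= yf c ea s u.
  have : s%:R <= ea%:R :> R by rewrite ler_nat ltnW.
  by have : 0 <= u%:R :> R by []; rewrite /yf; lra.
pose x (s : 'I_ea) (u : 'I_eb) := D + yf c ea s u.
have x0 s u : 0 <= x s u by rewrite addr_ge0.
pose Z := D - 1 + (c + ea%:R + eb%:R).
have sumZ (z : R) : \sum_(s < ea) \sum_(u < eb) z = ea%:R * eb%:R * z.
  by rewrite !sumr_const !card_ord -[LHS]mulr_natl -[z *+ eb]mulr_natl mulrA.
apply/andP; split; last first.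
  rewrite [leRHS](_ : _ = \sum_(s < ea) \sum_(u < eb) (p.+1%:R * (D * Z ^+ p))); last first.
    by rewrite sumZ WE /Z; ring.
  apply: ler_sum => s _; apply: ler_sum => u _.
  have /andP[_ /le_trans->//] := expr_sub_bounds p _ _ (y0 s u) D0.
  do 2 (apply: ler_wpM2l => //).
  apply: lerXn2r; rewrite ?nnegrE ?(x0 s u) //.
    by rewrite /Z; have : 0 <= ea%:R :> R by []; have : 0 <= eb%:R :> R by []; lra.
  have : u%:R + 1 <= eb%:R :> R by rewrite natr1 ler_nat.
  by have : 0 <= s%:R :> R by []; rewrite /yf /Z; lra.
apply: (@le_trans _ _ (\sum_(s < ea) \sum_(u < eb) D * x s u ^+ p)); last first.
  apply: ler_sum => s _; apply: ler_sum => u _.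
  by have /andP[] := expr_sub_bounds p _ _ (y0 s u) D0.
rewrite ler_pdivrMr ?exprn_gt0 // exprSr mulrA.
have rev : \sum_(s < ea) \sum_(u < eb) D * x s u ^+ p =
    \sum_(s < ea) \sum_(u < eb) D * x (rev_ord s) (rev_ord u) ^+ p.
  rewrite (reindex_inj rev_ord_inj); apply: eq_bigr => s _.
  by rewrite (reindex_inj rev_ord_inj).
rewrite -mulrA [_ * 2]mulrC mulrA mulr2n [_ * (1 + 1)]mulrDr mulr1 {2}rev -big_split /=.
rewrite mulr_suml [leLHS](_ : _ = \sum_(s < ea) \sum_(u < eb) (D * Z ^+ p)); last first.
  by rewrite sumZ WE /Z; ring.
apply: ler_sum => s _; rewrite -big_split /= mulr_suml; apply: ler_sum => u _.
rewrite -mulrDr -mulrA; apply: ler_wpM2l => //; rewrite mulrDl -!exprMn.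
have Z0 : 0 <= Z.
  by rewrite /Z; have : 0 <= ea%:R :> R by []; have : 0 <= eb%:R :> R by []; lra.
(* The two reflected lengths add up to 2 D + 2 c + ea + eb, which exceeds Z by D + c + 1. *)
have hZ : Z <= x s u + x (rev_ord s) (rev_ord u).
  rewrite /x /yf /Z /= !natrB ?ltn_ord // -!natr1.
  by have : 0 <= ea%:R :> R by []; lra.
have [h|h] := leP (Z / 2) (x s u).
  rewrite -[leLHS]addr0; apply: lerD; last by rewrite exprn_ge0 // mulr_ge0.
  by apply: lerXn2r; rewrite ?nnegrE ?mulr_ge0 //; lra.
rewrite -[leLHS]add0r; apply: lerD; first by rewrite exprn_ge0 // mulr_ge0.
by apply: lerXn2r; rewrite ?nnegrE ?mulr_ge0 //; lra.
Qed.

End BlockSums.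

(** * Decomposition of the index set into blocks *)

Section ExponentialNotation.
Variables (R : realType) (lam : seq nat) (m : nat) (l e : seq nat).
Hypothesis lam_exp : exp_notation lam m l e.

Let szle : size l = size e. Proof. by case: lam_exp. Qed.
Let lS : sorted gtn l. Proof. by case: lam_exp. Qed.
Let esum : sumn e = m. Proof. by case: lam_exp. Qed.
Let padE : pad lam m = flatten [seq nseq q.2 q.1 | q <- zip l e].
Proof. by case: lam_exp. Qed.

Definition offset (a : nat) : nat := sumn (take a e).

Lemma offsetS a : offset a.+1 = (offset a + nth 0%N e a)%N.
Proof.
rewrite /offset; elim: e a => [|x s IH] [|a] //=; first by rewrite take0 addn0.
by rewrite IH addnA.
Qed.

Lemma offset_le a b : (a <= b)%N -> (offset a <= offset b)%N.
Proof.
move=> ab; rewrite -(subnKC ab); elim: (b - a)%N => [|k IH]; first by rewrite addn0.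
by rewrite addnS offsetS (leq_trans IH) // leq_addr.
Qed.

Lemma offset_size : offset (size l) = m.
Proof. by rewrite szle /offset take_size. Qed.

Lemma sum_blocks (V : nmodType) (F : nat -> V) :
  \sum_(i < m) F i =
  \sum_(a < size l) \sum_(s < nth 0%N e a) F (offset a + s)%N.
Proof.
rewrite szle -esum /offset; elim: e F => [|x s IH] F; first by rewrite !big_ord0.
rewrite /= big_split_ord big_ord_recl /=; congr (_ + _); rewrite (IH (fun i => F (x + i)%N)).
by apply: eq_bigr => a _; apply: eq_bigr => u _; rewrite addnA.
Qed.

Lemma nth_pad_block a s : (a < size l)%N -> (s < nth 0%N e a)%N ->
  nth 0%N (pad lam m) (offset a + s) = nth 0%N l a.
Proof.
rewrite padE /offset; move: szle; clear; elim: l e a => [|x l' IH] [|y e'] [|a] //= [sz].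
  by move=> _ h; rewrite nth_cat size_nseq h nth_nseq h.
move=> ha hs; rewrite nth_cat size_nseq -addnA ltnNge leq_addr /= addKn.
by rewrite -[flatten _]/(flatten [seq nseq q.2 q.1 | q <- zip l' e']) IH.
Qed.

Lemma l_lt a b : (a < b)%N -> (b < size l)%N -> (nth 0%N l b < nth 0%N l a)%N.
Proof.
move=> ab bs.
have := lS; rewrite sorted_pairwise; last by move=> x y z /= h1 h2; exact: ltn_trans h2 h1.
by move/(pairwiseP 0%N) => h; apply: h; rewrite ?inE // (ltn_trans ab).
Qed.

Lemma diff_ge1 a b : (a < b)%N -> (b < size l)%N -> 1 <= Defs.diff R l a b.
Proof. by move=> ab bs; rewrite /Defs.diff lerBrDr -[1]/(1%:R) -natrD ler_nat add1n l_lt. Qed.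

Definition blockZ (a b : nat) : R :=
  Defs.diff R l a b - 1 + \sum_(a <= i < b.+1) (nth 0%N e i)%:R.

Lemma sum_e a b : (a <= b)%N ->
  \sum_(a <= i < b) (nth 0%N e i)%:R = (offset b)%:R - (offset a)%:R :> R.
Proof.
move=> ab; rewrite -(telescope_sumr (fun i => (offset i)%:R : R) ab).
by apply: eq_bigr => i _; rewrite offsetS natrD addrC addKr.
Qed.

Lemma hook_sumE d : hook_sum R lam m d.+1 =
  \sum_(b < size l) \sum_(a < size l | (a < b)%N)
    \sum_(s < nth 0%N e a) \sum_(u < nth 0%N e b)
      let y := (offset b + u - (offset a + s))%:R in
      (Defs.diff R l a b + y) ^+ d.+1 - y ^+ d.+1.
Proof.
pose F i j : R := if (i < j)%N then
  ((hook (pad lam m) i j)%:R ^+ d.+1 - (j - i)%:R ^+ d.+1) else 0.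
transitivity (\sum_(i < m) \sum_(j < m) F i j).
  by rewrite /hook_sum; apply: eq_bigr => i _; rewrite [LHS]big_mkcond.
rewrite (sum_blocks _ (fun i => \sum_(j < m) F i j)).
transitivity (\sum_(a < size l) \sum_(s < nth 0%N e a) \sum_(b < size l)
   \sum_(u < nth 0%N e b) F (offset a + s)%N (offset b + u)%N).
  by apply: eq_bigr => a _; apply: eq_bigr => s _; exact: sum_blocks.
transitivity (\sum_(a < size l) \sum_(b < size l) \sum_(s < nth 0%N e a)
   \sum_(u < nth 0%N e b) F (offset a + s)%N (offset b + u)%N).
  by apply: eq_bigr => a _; rewrite exchange_big.
rewrite exchange_big; apply: eq_bigr => b _ /=; rewrite [RHS]big_mkcond /=.
apply: eq_bigr => a _; case: ifP => ab.
  apply: eq_bigr => s _; apply: eq_bigr => u _.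
  have h1 := offset_le a.+1 b ab; rewrite offsetS in h1.
  have hs := ltn_ord s.
  rewrite /F ifT; last by lia.
  rewrite /hook !nth_pad_block //; congr (_ ^+ _ - _).
  by rewrite natrD natrB // ltnW // l_lt.
rewrite big1 // => s _; rewrite big1 // => u _; rewrite /F.
(* Within one block the parts are equal, the hook is j - i and the term vanishes. A later block
   before an earlier one contradicts i < j. *)
case: ifP => // h; have [ab'|ba] := leqP a b.
  have e_ab : a = b by apply: val_inj => /=; lia.
  move: s h; rewrite e_ab => s h.
  by rewrite /hook !nth_pad_block // subnn add0n subrr.
have h1 := offset_le b.+1 a ba; rewrite offsetS in h1.
by have := ltn_ord u; lia.
Qed.

Lemma hook_sum_bounds d : pair_sum R l e d / 2 ^+ d.+1 <=
  hook_sum R lam m d.+1 <= d.+1%:R * pair_sum R l e d.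
Proof.
rewrite hook_sumE /pair_sum mulr_suml mulr_sumr.
have block (a b : 'I_(size l)) : (a < b)%N ->
  Defs.diff R l a b * (nth 0%N e a)%:R * (nth 0%N e b)%:R * blockZ a b ^+ d / 2 ^+ d.+1 <=
  \sum_(s < nth 0%N e a) \sum_(u < nth 0%N e b)
      (let y := (offset b + u - (offset a + s))%:R in
      (Defs.diff R l a b + y) ^+ d.+1 - y ^+ d.+1) <= d.+1%:R *
  (Defs.diff R l a b * (nth 0%N e a)%:R * (nth 0%N e b)%:R * blockZ a b ^+ d).
  move=> ab; have ob := offset_le a.+1 b ab.
  pose c : R := (offset b)%:R - (offset a.+1)%:R.
  have c0 : 0 <= c by rewrite subr_ge0 ler_nat.
  have := block_bounds R d (nth 0%N e a) (nth 0%N e b) (Defs.diff R l a b) c _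
    (diff_ge1 _ _ ab (ltn_ord b)) c0 erefl.
  have -> : Defs.diff R l a b - 1 + (c + (nth 0%N e a)%:R + (nth 0%N e b)%:R) = blockZ a b.
    rewrite /blockZ sum_e; last by rewrite ltnW // ltnW.
    by rewrite /c !offsetS !natrD; ring.
  rewrite (eq_bigr (fun s : 'I_(nth 0%N e a) => \sum_(u < nth 0%N e b)
      ((Defs.diff R l a b + (offset b + u - (offset a + s))%:R) ^+ d.+1 -
       (offset b + u - (offset a + s))%:R ^+ d.+1))) // => s _.
  apply: eq_bigr => u _; suff -> : c + ((nth 0%N e a)%:R - s%:R) + u%:R =
    (offset b + u - (offset a + s))%:R by [].
  rewrite offsetS in ob; have hs := ltn_ord s.
  by rewrite natrB ?natrD /c ?offsetS ?natrD; [ring|lia].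
apply/andP; split; apply: ler_sum => b _; rewrite ?mulr_suml ?mulr_sumr;
  by apply: ler_sum => a ab; have /andP[] := block a b ab.
Qed.

Lemma pair_sum_ge0 d : 0 <= pair_sum R l e d.
Proof.
apply: sumr_ge0 => b _; apply: sumr_ge0 => a ab.
have D1 := diff_ge1 _ _ ab (ltn_ord b).
rewrite !mulr_ge0 ?exprn_ge0 //; first by lra.
by rewrite addr_ge0 ?sumr_ge0 //; lra.
Qed.

(** Every factor [blockZ a b] is at most l_1 - l_k - 1 + m, the quantity squared in the denominator
    of [weft]. *)
Lemma pair_sum_le d : pair_sum R l e d.+1 <=
  pair_sum R l e 1 * (Defs.diff R l 0 (size l).-1 - 1 + m%:R) ^+ d.
Proof.
rewrite /pair_sum mulr_suml; apply: ler_sum => b _; rewrite mulr_suml.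
apply: ler_sum => a ab; have D1 := diff_ge1 _ _ ab (ltn_ord b).
have Z0 : 0 <= blockZ a b by rewrite addr_ge0 ?sumr_ge0 //; lra.
rewrite exprS expr1 mulrA; apply: ler_wpM2l.
  by rewrite !mulr_ge0 //; lra.
have ds i j : (i <= j)%N -> (j < size l)%N -> (nth 0%N l j <= nth 0%N l i)%N.
  by rewrite leq_eqVlt => /orP[/eqP->//|ij js]; rewrite ltnW // l_lt.
have bs := ltn_ord b.
apply: lerXn2r; rewrite ?nnegrE //.
  apply: le_trans Z0 _.
all: suff : blockZ a b <= Defs.diff R l 0 (size l).-1 - 1 + m%:R by [].
all: rewrite /blockZ sum_e; last by rewrite ltnW // ltnW.
all: have o1 : (offset b.+1)%:R <= m%:R :> R by rewrite ler_nat -offset_size offset_le.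
all: have o2 : 0 <= (offset a)%:R :> R by [].
all: have l1 : (nth 0%N l a)%:R <= (nth 0%N l 0)%:R :> R by rewrite ler_nat ds // (ltn_trans ab).
all: have l2 : (nth 0%N l (size l).-1)%:R <= (nth 0%N l b)%:R :> R by rewrite ler_nat ds //; lia.
all: by rewrite /Defs.diff; lra.
Qed.

End ExponentialNotation.

(** * Taylor bounds and the moments of the normal law *)

Section Taylor.
Variable R : realType.

Lemma MVT_has_derivative (f f' : R -> R) (x : R) : has_derivative R f f' ->
  0 <= x -> exists2 c, 0 <= c <= x & f x - f 0 = f' c * x.
Proof.
move=> df x0; have [|c] := @MVT_segment R f f' 0 x x0 (fun y _ => df y).
  apply: continuous_subspaceT => y; apply: differentiable_continuous.
  by apply/derivable1_diffP; have [] := df y.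
by rewrite in_itv /= subr0 => hc ->; exists c.
Qed.

Lemma has_derivative_expn n :
  has_derivative R (fun x => x ^+ n.+1) (fun x => n.+1%:R * x ^+ n).
Proof.
elim: n => [|n IH] x.
  by apply: (is_derive_eq (has_derivative_id R x)); rewrite expr0 mulr1.
have := has_derivativeM _ _ _ _ _ (has_derivative_id R) IH x => h.
rewrite (_ : (fun x : R => x ^+ n.+2) = fun x => x * x ^+ n.+1); last first.
  by apply/funext => y; rewrite exprS.
by apply: (is_derive_eq h); rewrite exprS -[n.+2%:R]natr1; ring.
Qed.

Lemma has_derivative_sum n (F F' : nat -> R -> R) :
  (forall i, has_derivative R (F i) (F' i)) ->
  has_derivative R (fun x => \sum_(i < n) F i x) (fun x => \sum_(i < n) F' i x).
Proof.
move=> dF; elim: n => [|n IH] x.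
  rewrite (_ : (fun x => \sum_(i < 0) F i x) = fun=> 0); last first.
    by apply/funext => y; rewrite big_ord0.
  by rewrite big_ord0; exact: has_derivative_cst.
rewrite (_ : (fun x => \sum_(i < n.+1) F i x) = fun x => \sum_(i < n) F i x + F n x); last first.
  by apply/funext => y; rewrite big_ord_recr.
by rewrite big_ord_recr; exact: (has_derivativeD _ _ _ _ _ IH (dF n) x).
Qed.

(** Here [F j] stands for the j-th derivative of [F 0], so that derivatives known in closed form can
    be supplied directly. *)
Definition taylor (F : nat -> R -> R) n (x : R) : R :=
  \sum_(j < n) F j 0 * (x ^+ j / j`!%:R).

Lemma taylorS F n x : taylor F n.+1 x =
  F 0%N 0 + \sum_(j < n) F j.+1 0 * (x ^+ j.+1 / j.+1`!%:R).
Proof. by rewrite /taylor big_ord_recl expr0 fact0 divr1 mulr1. Qed.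

Lemma has_derivative_taylor F n :
  has_derivative R (taylor F n.+1) (taylor (fun k => F k.+1) n).
Proof.
pose T j (x : R) := F j.+1 0 * (x ^+ j.+1 / j.+1`!%:R).
pose T' j (x : R) := F j.+1 0 * (x ^+ j / j`!%:R).
have dT j : has_derivative R (T j) (T' j).
  apply: has_derivativeZ => x.
  have := has_derivativeZ _ _ (j.+1`!%:R^-1) _ (has_derivative_expn j) x => h.
  rewrite (_ : (fun x : R => x ^+ j.+1 / j.+1`!%:R) = fun t => j.+1`!%:R^-1 * t ^+ j.+1); last first.
    by apply/funext => y; rewrite mulrC.
  apply: (is_derive_eq h); rewrite factS natrM.
  have : j.+1%:R != 0 :> R by rewrite pnatr_eq0.
  have : j`!%:R != 0 :> R by rewrite pnatr_eq0 -lt0n fact_gt0.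
  by move=> ? ?; field; apply/andP.
have h := has_derivativeD _ _ _ _ _ (has_derivative_cst R (F 0%N 0)) (has_derivative_sum n T T' dT).
move=> x; rewrite (_ : taylor F n.+1 = fun t => F 0%N 0 + \sum_(j < n) T j t).
  by apply: (is_derive_eq (h x)); rewrite add0r.
by apply/funext => y; rewrite taylorS.
Qed.

Lemma taylor0 F n : taylor F n.+1 0 = F 0%N 0.
Proof. by rewrite taylorS big1 ?addr0 // => j _; rewrite expr0n mul0r mulr0. Qed.

(** Induction on the order: the derivative of the remainder is the remainder of F' one order lower.
    The mean value theorem, applied to B x^n / n! plus or minus the remainder, shows both
    combinations to be nonnegative. *)
Let taylor_bound_ge0 (F : nat -> R -> R) n (B x : R) : (forall k, has_derivative R (F k) (F k.+1)) ->
  0 <= x -> (forall y, 0 <= y <= x -> `|F n y| <= B) ->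
  `|F 0%N x - taylor F n x| <= B * (x ^+ n / n`!%:R).
Proof.
elim: n F x => [|n IH] F x dF x0 hB.
  by rewrite /taylor big_ord0 subr0 fact0 expr0 divr1 mulr1; apply: hB; rewrite x0 lexx.
pose P (y : R) := y ^+ n.+1 / n.+1`!%:R.
have dP : has_derivative R P (fun y => y ^+ n / n`!%:R).
  move=> y; have := has_derivativeZ _ _ (n.+1`!%:R^-1) _ (has_derivative_expn n) y => h.
  rewrite (_ : P = fun t => n.+1`!%:R^-1 * t ^+ n.+1); last first.
    by apply/funext => t; rewrite /P mulrC.
  apply: (is_derive_eq h); rewrite factS natrM.
  have : n.+1%:R != 0 :> R by rewrite pnatr_eq0.
  have : n`!%:R != 0 :> R by rewrite pnatr_eq0 -lt0n fact_gt0.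
  by move=> ? ?; field; apply/andP.
have dT := has_derivative_taylor F n.
have P0 : P 0 = 0 by rewrite /P expr0n mul0r.
have IHc c : 0 <= c <= x -> `|F 1%N c - taylor (fun k => F k.+1) n c| <= B * (c ^+ n / n`!%:R).
  move=> /andP[c0 cx]; apply: (IH (fun k => F k.+1)) => // y /andP[y0 yc].
  by apply: hB; rewrite y0 (le_trans yc cx).
have side (s : R) : `|s| = 1 -> 0 <= B * P x + s * (F 0%N x - taylor F n.+1 x).
  move=> s1.
  have dG := has_derivativeD _ _ _ _ _ (has_derivativeZ _ _ B _ dP)
    (has_derivativeZ _ _ s _ (has_derivativeD _ _ _ _ _ (dF 0%N)
      (has_derivativeZ _ _ (-1) _ dT))).
  have [c /andP[c0 cx] /=] := MVT_has_derivative _ _ x dG x0.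
  rewrite P0 taylor0 !mulN1r subrr !mulr0 addr0 subr0 => ->.
  apply: mulr_ge0 => //; have := IHc c; rewrite c0 cx => /(_ isT).
  set u := F 1%N c - _; set v := B * _ => uv.
  have : - (s * u) <= `|u| by rewrite (le_trans (ler_norm _)) // normrN normrM s1 mul1r.
  by lra.
have h1 := side 1 (normr1 _); have h2 := side (-1) (normrN1 _).
by rewrite ler_norml -/(P x); apply/andP; split; lra.
Qed.

Lemma taylor_bound (F : nat -> R -> R) n (B x : R) : (forall k, has_derivative R (F k) (F k.+1)) ->
  (forall y, `|y| <= `|x| -> `|F n y| <= B) ->
  `|F 0%N x - taylor F n x| <= B * (`|x| ^+ n / n`!%:R).
Proof.
move=> dF hB; have [x0|x0] := leP 0 x.
  rewrite (ger0_norm x0); apply: taylor_bound_ge0 => // y /andP[y0 yx].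
  by apply: hB; rewrite !ger0_norm.
pose G k (y : R) := (-1) ^+ k * F k (-1 * y).
have dG k : has_derivative R (G k) (G k.+1).
  move=> y; have h := has_derivativeZ _ _ ((-1) ^+ k) _ (has_derivative_scale _ _ (-1) _ (dF k)).
  by apply: (is_derive_eq (h y)); rewrite /G exprS; ring.
have nx0 : 0 <= - x by lra.
have := taylor_bound_ge0 G n B (- x) dG nx0; rewrite (ltr0_norm x0).
rewrite /G expr0 mul1r mulN1r opprK.
rewrite (_ : taylor (fun k y => _) n (- x) = taylor F n x); last first.
  apply: eq_bigr => j _; rewrite mulr0 [(- x) ^+ j]exprNn; set s := (-1) ^+ j.
  have : s * s = 1 by rewrite /s -exprD addnn -signr_odd odd_double.
  by set f := F j 0 => ss; transitivity ((s * s) * (f * (x ^+ j / j`!%:R))); [ring|rewrite ss mul1r].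
apply=> // y /andP[y0 yx]; rewrite normrM normrX normrN1 expr1n mul1r.
by apply: hB; rewrite mulN1r normrN (ltr0_norm x0) (ger0_norm y0).
Qed.

(** Take the n-th power of |x| / n <= 1 + |x| / n <= e^(|x|/n). *)
Lemma normX_le_exp n (x : R) : `|x| ^+ n <= n%:R ^+ n * expR `|x|.
Proof.
case: n => [|n]; first by rewrite !expr0 mul1r -[leLHS]expR0 ler_expR.
have n0 : 0 < n.+1%:R :> R by [].
have -> : expR `|x| = expR (`|x| / n.+1%:R) ^+ n.+1.
  by rewrite -expRM_natl mulrC divfK // lt0r_neq0.
rewrite -exprMn; apply: lerXn2r; rewrite ?nnegrE ?mulr_ge0 ?expR_ge0 //.
rewrite -ler_pdivrMl // mulrC; apply: le_trans (expR_ge1Dx _).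
by rewrite lerDr.
Qed.

Lemma exp_norm_le (x : R) : expR `|x| <= expR x + expR (- x).
Proof.
have [x0|x0] := leP 0 x; first by rewrite ger0_norm // lerDl expR_ge0.
by rewrite ltr0_norm // lerDr expR_ge0.
Qed.

(** Used to compare coefficients of two expansions as s tends to 0 from the right. *)
Lemma coef_eq0 (c C : R) : (forall s, 0 < s <= 1 -> `|c| <= C * s) -> c = 0.
Proof.
move=> h; apply/eqP; rewrite -normr_le0; apply/ler_addgt0Pl => e e0.
rewrite addr0; have C0 : 0 <= C by have := h 1; rewrite ltr01 lexx mulr1 => /(_ isT); apply: le_trans.
pose s := Num.min 1 (e / (C + 1)).
have s0 : 0 < s by rewrite lt_min ltr01 divr_gt0 //; lra.
apply: (le_trans (h s _)); first by rewrite s0 ge_min lexx.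
have : s <= e / (C + 1) by rewrite ge_min lexx orbT.
rewrite ler_pdivlMr; last by lra.
by nra.
Qed.

End Taylor.

(** * Moments of the standard normal law *)

Section GaussianMoments.
Variable R : realType.
Notation mu := (@lebesgue_measure R).
Notation phi := (normal_pdf (0 : R) (1 : R)).

Definition gint (f : R -> R) : Prop :=
  measurable_fun [set: R] f /\ mu.-integrable [set: R] (EFin \o (fun x => f x * phi x)).

Definition gexp (f : R -> R) : R := \int[mu]_x (f x * phi x).

Let phi_ge0 x : 0 <= phi x. Proof. exact: normal_pdf_ge0. Qed.

Lemma gint_le (f g : R -> R) : measurable_fun [set: R] f -> gint g ->
  (forall x, `|f x| <= g x) -> gint f.
Proof.
move=> mf [mg ig] fg; split => //; apply: le_integrable ig => //.
  apply/measurable_EFinP; apply: measurable_funM => //; exact: measurable_normal_pdf.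
move=> x _ /=; rewrite lee_fin !normrM ler_wpM2r //.
by rewrite (le_trans (fg x)) // ler_norm.
Qed.

Lemma gintD f g : gint f -> gint g -> gint (fun x => f x + g x).
Proof.
move=> [mf jf] [mg jg]; split; first exact: measurable_funD.
have := integrableD measurableT jf jg; apply: eq_integrable => // x _ /=.
by rewrite -EFinD mulrDl.
Qed.

Lemma gintZ a f : gint f -> gint (fun x => a * f x).
Proof.
move=> [mf jf]; split; first exact: measurable_funM.
have := integrableZl measurableT a jf; apply: eq_integrable => // x _ /=.
by rewrite -EFinM mulrA.
Qed.

Lemma gexpD f g : gint f -> gint g -> gexp (fun x => f x + g x) = gexp f + gexp g.
Proof.
move=> [_ jf] [_ jg]; rewrite /gexp -RintegralD //.
by apply: eq_Rintegral => x _; rewrite mulrDl.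
Qed.

Lemma gexpZ a f : gint f -> gexp (fun x => a * f x) = a * gexp f.
Proof.
move=> [_ jf]; rewrite /gexp -RintegralZl //.
by apply: eq_Rintegral => x _; rewrite mulrA.
Qed.

Lemma gexp_le f g : gint f -> gint g -> (forall x, f x <= g x) -> gexp f <= gexp g.
Proof.
move=> [_ jf] [_ jg] fg; apply: le_Rintegral => // x _.
by apply: ler_wpM2r.
Qed.

(** Completing the square: s x - x^2 / 2 = s^2 / 2 - (x - s)^2 / 2. *)
Lemma phi_shift s x : expR (s * x) * phi x = expR (s ^+ 2 / 2) * normal_pdf s 1 x.
Proof.
rewrite !normal_pdfE ?oner_eq0 // !(mulrCA _ (normal_peak 1)); congr (_ * _).
by rewrite /normal_fun -!expRD; congr expR; rewrite -mulr_natl; field.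
Qed.

Lemma gint_exp s : gint (fun x => expR (s * x)).
Proof.
split; first by apply: measurableT_comp => //; exact: measurable_funM.
have := integrableZl measurableT (expR (s ^+ 2 / 2)) (integrable_normal_pdf s 1).
by apply: eq_integrable => // x _ /=; rewrite -EFinM phi_shift.
Qed.

Lemma gexp_exp s : gexp (fun x => expR (s * x)) = expR (s ^+ 2 / 2).
Proof.
transitivity (\int[mu]_x (expR (s ^+ 2 / 2) * normal_pdf s 1 x)).
  by rewrite /gexp; apply: eq_Rintegral => x _; rewrite phi_shift.
rewrite RintegralZl //; last exact: integrable_normal_pdf.
by rewrite /Rintegral integral_normal_pdf mulr1.
Qed.

Lemma gint_cst c : gint (fun=> c).
Proof.
apply: (gint_le _ (fun x => `|c| * expR (0 * x))) => //; first exact/gintZ/gint_exp.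
by move=> x; rewrite mul0r expR0 mulr1.
Qed.

Lemma gexp_cst c : gexp (fun=> c) = c.
Proof.
transitivity (gexp (fun x => c * expR (0 * x))).
  by rewrite /gexp; apply: eq_Rintegral => x _; rewrite mul0r expR0 mulr1.
by rewrite gexpZ ?gexp_exp ?expr0n ?mul0r ?expR0 ?mulr1 //; exact: gint_exp.
Qed.

Lemma gint_bounded (f : R -> R) B : measurable_fun [set: R] f -> (forall x, `|f x| <= B) -> gint f.
Proof. by move=> mf fB; apply: (gint_le _ (fun=> B)) => //; exact: gint_cst. Qed.

Lemma gint_expn n : gint (fun x => x ^+ n).
Proof.
apply: (gint_le _ (fun x => n%:R ^+ n * (expR (1 * x) + expR (-1 * x)))).
- exact: measurable_funX.
- by apply: gintZ; apply: gintD; exact: gint_exp.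
move=> x; rewrite normrX (le_trans (normX_le_exp _ _ _)) //.
by rewrite ler_wpM2l ?exprn_ge0 // mul1r mulN1r exp_norm_le.
Qed.

Lemma gint_sum n (F : nat -> R -> R) : (forall j, gint (F j)) ->
  gint (fun x => \sum_(j < n) F j x).
Proof.
move=> jF; elim: n => [|n IH].
  rewrite (_ : (fun _ => _) = fun=> 0); first exact: gint_cst.
  by apply/funext => x; rewrite big_ord0.
rewrite (_ : (fun _ => _) = fun x => \sum_(j < n) F j x + F n x); first exact: gintD.
by apply/funext => x; rewrite big_ord_recr.
Qed.

Lemma gexp_sum n (F : nat -> R -> R) : (forall j, gint (F j)) ->
  gexp (fun x => \sum_(j < n) F j x) = \sum_(j < n) gexp (F j).
Proof.
move=> jF; elim: n => [|n IH].
  rewrite big_ord0 (_ : (fun _ => _) = fun=> 0) ?gexp_cst //.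
  by apply/funext => x; rewrite big_ord0.
rewrite (_ : (fun _ => _) = fun x => \sum_(j < n) F j x + F n x); last first.
  by apply/funext => x; rewrite big_ord_recr.
by rewrite gexpD ?IH ?big_ord_recr //; exact: gint_sum.
Qed.

(** Carries two consecutive moments, which makes the two-step recursion structural. *)
Fixpoint gmom2 n : R * R :=
  if n is n'.+1 then let: (a, b) := gmom2 n' in (b, n'.+1%:R * a) else (1, 0).

(* The moments 1, 0, 1, 0, 3, 0, 15, ... of the standard normal law. *)
Definition gmom n : R := (gmom2 n).1.

Lemma gmomSS n : gmom n.+2 = n.+1%:R * gmom n.
Proof. by rewrite /gmom /=; case: (gmom2 n). Qed.

Let m (s : R) : R := expR (s ^+ 2 / 2).

Let has_derivative_m : has_derivative R m (fun s => s * m s).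
Proof.
have h := has_derivative_comp _ _ _ _ _ (fun x : R => is_derive_expR x)
  (has_derivativeZ _ _ (2^-1) _ (has_derivative_expn R 1)).
move=> x; rewrite (_ : m = fun t => expR (2^-1 * t ^+ 2)).
  by apply: (is_derive_eq (h x)); rewrite expr1; field.
by apply/funext => t; rewrite /m mulrC.
Qed.

Let nderivable_m n : nderivable R n m.
Proof.
elim: n => [//|n IH]; apply: nderivableS has_derivative_m _.
by apply: nderivableM => //; exact: nderivable_id.
Qed.

(** In Leibniz' rule for m' = s m only the first derivative of s survives at 0, which leaves the
    recursion of [gmomSS]. *)
Let derive1n_m n : derive1n n m 0 = gmom n.
Proof.
suff [] : derive1n n m 0 = gmom n /\ derive1n n.+1 m 0 = gmom n.+1 by [].
elim: n => [|n [IH0 IH1]].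
  split; first by rewrite /= /m expr0n mul0r expR0.
  by rewrite derive1Sn (derive1_has_derivative _ _ _ has_derivative_m) /= mul0r.
split=> //; rewrite gmomSS derive1Sn (derive1_has_derivative _ _ _ has_derivative_m).
rewrite derive1nM //; last exact: nderivable_id.
rewrite big_ord_recl big_ord_recl big1 => [|i _].
  rewrite derive1n0 mulr0 mul0r add0r addr0 /bump /= bin1 subSS subn0 IH0.
  by rewrite (derive1_has_derivative _ _ _ (has_derivative_id R)) mulr1.
rewrite [X in derive1n X _ _](_ : _ = i.+2)%N // derive1Sn.
by rewrite (derive1_has_derivative _ _ _ (has_derivative_id R)) derive1n_cst mulr0 mul0r.
Qed.

Let Mtay n s : \sum_(j < n) gexp (fun x => x ^+ j) * (s ^+ j / j`!%:R) =
  gexp (fun x => taylor R (fun k s => x ^+ k * expR (x * s)) n s).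
Proof.
pose F j (x : R) := x ^+ j * expR (x * 0) * (s ^+ j / j`!%:R).
transitivity (\sum_(j < n) gexp (F j)).
  apply: eq_bigr => j _; rewrite /F.
  transitivity (gexp (fun x => (s ^+ j / j`!%:R) * x ^+ j)).
    by rewrite gexpZ; [rewrite mulrC|exact: gint_expn].
  by rewrite /gexp; apply: eq_Rintegral => x _; rewrite mulr0 expR0 mulr1 [_ * x ^+ j]mulrC.
symmetry; apply: (gexp_sum n F) => j.
rewrite /F (_ : (fun _ => _) = fun x => (s ^+ j / j`!%:R) * x ^+ j).
  by apply: gintZ; exact: gint_expn.
by apply/funext => x; rewrite mulr0 expR0 mulr1 mulrC.
Qed.

(** Expands e^(s x) in s under the integral, so the coefficients are the true moments. [remainder_m]
    expands the closed form e^(s^2/2) of the same integral. *)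
Let remainder n : exists C : R, forall s, 0 < s <= 1 ->
  `|m s - \sum_(j < n) gexp (fun x => x ^+ j) * (s ^+ j / j`!%:R)| <= C * s ^+ n.
Proof.
(* For 0 < s <= 1 the n-th derivative in s is at most |x|^n e^|x| <= n^n e^(2|x|), and K is an
   integrable bound for e^(2|x|). *)
pose K x : R := expR (2 * x) + expR (-2 * x).
pose T s (x : R) := taylor R (fun k s => x ^+ k * expR (x * s)) n s.
have jK : gint K by apply: gintD; exact: gint_exp.
pose c : R := n%:R ^+ n / n`!%:R.
exists (c * gexp K) => s /andP[s0 s1]; rewrite Mtay.
have jT : gint (T s).
  apply: (gint_sum n (fun j x => x ^+ j * expR (x * 0) * (s ^+ j / j`!%:R))) => j.
  rewrite (_ : (fun _ => _) = fun x => (s ^+ j / j`!%:R) * x ^+ j).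
    by apply: gintZ; exact: gint_expn.
  by apply/funext => x; rewrite mulr0 expR0 mulr1 mulrC.
have jE := gint_exp s.
have bnd x : `|expR (s * x) - T s x| <= c * s ^+ n * K x.
  have tb : `|expR (x * s) - T s x| <= n%:R ^+ n * K x * (`|s| ^+ n / n`!%:R).
    have := taylor_bound R (fun k s => x ^+ k * expR (x * s)) n (n%:R ^+ n * K x) s.
    rewrite expr0 mul1r; apply.
    move=> k t; apply: (is_derive_eq (has_derivativeZ _ _ (x ^+ k) _ (has_derivative_expM R x) t)).
      by rewrite exprSr; ring.
    move=> y; rewrite (gtr0_norm s0) => ys; rewrite normrM normrX [`|expR _|]ger0_norm ?expR_ge0 //.
    have h1 := normX_le_exp R n x.
    have h2 : expR (x * y) <= expR `|x|.
      rewrite ler_expR (le_trans (ler_norm _)) // normrM ler_piMr //.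
      exact: le_trans ys s1.
    apply: (@le_trans _ _ ((n%:R ^+ n * expR `|x|) * expR `|x|)).
      by apply: ler_pM; rewrite ?exprn_ge0 ?expR_ge0.
    rewrite -mulrA ler_wpM2l ?exprn_ge0 // -expRD.
    have -> : `|x| + `|x| = `|2 * x| by rewrite normrM ger0_norm //; ring.
    by rewrite (le_trans (exp_norm_le _ _)) // /K mulNr.
  rewrite [s * x]mulrC (le_trans tb) // (gtr0_norm s0) /c le_eqVlt.
  by apply/orP; left; apply/eqP; ring.
have dE : m s - gexp (T s) = gexp (fun x => expR (s * x) + -1 * T s x).
  by rewrite gexpD ?gexpZ ?gexp_exp ?mulN1r //; exact: gintZ.
have jD : gint (fun x => expR (s * x) + -1 * T s x) by apply: gintD => //; exact: gintZ.
have jB a : gint (fun x => a * K x) by exact: gintZ.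
rewrite -/(T s) dE ler_norml; apply/andP; split.
  rewrite (_ : - _ = gexp (fun x => - (c * s ^+ n) * K x)); last by rewrite gexpZ //; ring.
  apply: gexp_le => // x; have := bnd x; rewrite ler_norml => /andP[h _]; lra.
rewrite (_ : c * _ * _ = gexp (fun x => (c * s ^+ n) * K x)); last by rewrite gexpZ //; ring.
by apply: gexp_le => // x; have := bnd x; rewrite ler_norml => /andP[_ h]; lra.
Qed.

Let remainder_m n : exists C : R, forall s, 0 < s <= 1 ->
  `|m s - \sum_(j < n) gmom j * (s ^+ j / j`!%:R)| <= C * s ^+ n.
Proof.
have sm k : nderivable R 1 (derive1n k m).
  have: forall f, nderivable R k.+1 f -> nderivable R 1 (derive1n k f).
    by elim: k => [//|k IH] f [_ h]; rewrite derive1Sn; exact: IH.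
  by apply; exact: nderivable_m.
have [B hB] : exists B, forall y, `|y| <= 1 -> `|derive1n n m y| <= B.
  have cf : continuous (derive1n n m).
    move=> y; apply: differentiable_continuous; apply/derivable1_diffP.
    by have [h _] := sm n; have [] := h y.
  have cn : {within `[-1, 1], continuous (fun y => `|derive1n n m y|)}.
    by apply: continuous_subspaceT => y; apply: cvg_norm; exact: cf.
  have [|c _ hc] := @EVT_max R _ (-1) 1 _ cn; first by lra.
  exists `|derive1n n m c| => y; rewrite ler_norml => hy; apply: hc.
  by rewrite in_itv.
exists (B / n`!%:R) => s /andP[s0 s1].
have -> : B / n`!%:R * s ^+ n = B * (`|s| ^+ n / n`!%:R).
  by rewrite (gtr0_norm s0); ring.
have -> : \sum_(j < n) gmom j * (s ^+ j / j`!%:R) = taylor R (fun k => derive1n k m) n s.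
  by apply: eq_bigr => j _; rewrite derive1n_m.
apply: (taylor_bound R (fun k => derive1n k m)) => [k|y ys]; first by case: (sm k).
by apply: hB; rewrite (le_trans ys) // (gtr0_norm s0).
Qed.

(** By induction the two expansions agree below order n, so the n-th coefficients differ by a
    multiple of s for all small s. *)
Lemma gexp_expn n : gexp (fun x => x ^+ n) = gmom n.
Proof.
elim/ltn_ind: n => n IH.
have [C1 h1] := remainder n.+1; have [C2 h2] := remainder_m n.+1.
have f0 : 0 < n`!%:R :> R by rewrite ltr0n fact_gt0.
apply/eqP; rewrite -subr_eq0; apply/eqP.
apply: (coef_eq0 _ _ ((C1 + C2) * n`!%:R)) => s hs.
have := h1 s hs; have := h2 s hs; case/andP: hs => s0 s1.
rewrite !big_ord_recr /= (eq_bigr (fun j : 'I_n => gexp (fun x => x ^+ j) * (s ^+ j / j`!%:R))); last first.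
  by move=> j _; rewrite IH.
set S := \sum_(j < n) _; set a := gexp _; set b := gmom n => k2 k1.
have : `|(a - b) * (s ^+ n / n`!%:R)| <= (C1 + C2) * s ^+ n.+1.
  rewrite (_ : (a - b) * _ = (m s - (S + b * (s ^+ n / n`!%:R))) - (m s - (S + a * (s ^+ n / n`!%:R)))); last by ring.
  by rewrite (le_trans (ler_normB _ _)) // mulrDl addrC lerD.
have sn0 : 0 < s ^+ n by rewrite exprn_gt0.
rewrite normrM [`|_ / _|]gtr0_norm ?divr_gt0 // exprS.
rewrite mulrA ler_pdivrMr // => k; rewrite -(ler_pM2r sn0); apply: le_trans k _.
by rewrite le_eqVlt; apply/orP; left; apply/eqP; ring.
Qed.

End GaussianMoments.

(** * The method of moments *)

Section RealSequences.
Variable R : realType.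
Implicit Types (u v : nat -> R).

Lemma cvgnP u (l : R) : u N @[N --> \oo] --> l <->
  forall e : R, 0 < e -> exists N0, forall N, (N0 <= N)%N -> `|u N - l| <= e.
Proof.
split=> [/cvgrPdist_le h e /h [N0 _ hN]|h].
  by exists N0 => N /hN /=; rewrite distrC.
apply/cvgrPdist_le => e /h [N0 hN]; exists N0 => // N /= /hN.
by rewrite distrC.
Qed.

Lemma cvgn_sum n (F : nat -> nat -> R) (L : nat -> R) :
  (forall i, (i < n)%N -> F i N @[N --> \oo] --> L i) ->
  \sum_(i < n) F i N @[N --> \oo] --> \sum_(i < n) L i.
Proof.
elim: n => [|n IH] h.
  under eq_fun do rewrite big_ord0; rewrite big_ord0; exact: cvg_cst.
under eq_fun do rewrite big_ord_recr; rewrite big_ord_recr /=.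
by apply: cvgD; [apply: IH => i hi; apply: h; rewrite ltnW|exact: h].
Qed.

End RealSequences.

(** * Polynomials approximating a step *)

Section StepPolynomials.
Variable R : realType.

(* [step_poly n] is close to the indicator of [1/2, 1] on the unit interval,
   away from 1/2. *)
Definition step_poly n : {poly R} := 1 - (1 - 'X^n) ^+ (2 ^ n).

Lemma horner_step_poly n y : (step_poly n).[y] = 1 - (1 - y ^+ n) ^+ (2 ^ n).
Proof. by rewrite /step_poly !hornerE. Qed.

Lemma bernoulli_le (u : R) k : -1 <= u -> 1 + k%:R * u <= (1 + u) ^+ k.
Proof.
move=> u1; elim: k => [|k IH]; first by rewrite mul0r addr0 expr0.
rewrite exprS -natr1; apply: (@le_trans _ _ ((1 + u) * (1 + k%:R * u))).
  have : 0 <= k%:R * u ^+ 2 by rewrite mulr_ge0 ?sqr_ge0.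
  by rewrite expr2; lra.
by apply: ler_wpM2l => //; lra.
Qed.

Lemma step_poly_itv n y : 0 <= y <= 1 -> 0 <= (step_poly n).[y] <= 1.
Proof.
move=> /andP[y0 y1]; rewrite horner_step_poly.
have h1 : 0 <= 1 - y ^+ n by rewrite subr_ge0 exprn_ile1.
have h2 : 1 - y ^+ n <= 1 by rewrite gerBl exprn_ge0.
have h3 : 0 <= (1 - y ^+ n) ^+ (2 ^ n) by rewrite exprn_ge0.
have h4 : (1 - y ^+ n) ^+ (2 ^ n) <= 1 by rewrite exprn_ile1.
by apply/andP; split; lra.
Qed.

(** Bernoulli's inequality gives (1 - y^n)^(2^n) >= 1 - (2 y)^n. *)
Lemma step_poly_le n y : 0 <= y <= 1 -> (step_poly n).[y] <= (2 * y) ^+ n.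
Proof.
move=> /andP[y0 y1]; rewrite horner_step_poly.
have u1 : -1 <= - y ^+ n by rewrite lerN2 exprn_ile1.
have := bernoulli_le _ (2 ^ n) u1; rewrite natrX mulrN -exprMn.
by lra.
Qed.

(** With u = y^n and k = 2^n, the product (1 - u)^k (1 + u)^k is at most 1, while Bernoulli bounds
    (1 + u)^k below by 1 + k u >= (2 y)^n. *)
Lemma step_poly_ge n y : 0 <= y <= 1 -> 0 < y -> 1 - (2 * y) ^- n <= (step_poly n).[y].
Proof.
move=> /andP[_ y1] y0; rewrite horner_step_poly lerD2l lerN2.
set u := y ^+ n; have u0 : 0 < u by rewrite exprn_gt0.
have u1 : u <= 1 by rewrite exprn_ile1 // ltW.
have h0 : 0 < (2 * y) ^+ n by rewrite exprn_gt0 // mulr_gt0.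
rewrite -[leRHS]mul1r -ler_pdivrMr ?invr_gt0 // invrK.
apply: (@le_trans _ _ ((1 - u) ^+ (2 ^ n) * (1 + u) ^+ (2 ^ n))).
  apply: ler_wpM2l; first by rewrite exprn_ge0 // subr_ge0.
  have /(_ (2 ^ n)%N) := bernoulli_le u _; rewrite natrX -exprMn => /(_ _).
  by move=> h; apply: le_trans (h _); lra.
by rewrite -exprMn exprn_ile1 //; nra.
Qed.

Lemma expr_small (z e : R) : 0 <= z < 1 -> 0 < e -> exists n, z ^+ n <= e.
Proof.
move=> /andP[z0 z1] e0; have : `|z| < 1 by rewrite ger0_norm.
move/cvg_expr/cvgnP/(_ e e0) => [n hn]; exists n.
by have := hn n (leqnn n); rewrite subr0 ger0_norm // exprn_ge0.
Qed.

Lemma step_poly_sep (eta e : R) : 0 < eta <= 1 -> 0 < e -> exists n,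
  (forall y, 0 <= y <= (1 - eta) / 2 -> (step_poly n).[y] <= e) /\
  (forall y, (1 + eta) / 2 <= y <= 1 -> 1 - e <= (step_poly n).[y]).
Proof.
(* z bounds 2 y on the lower interval and 1 / (2 y) on the upper one, so a single n serves both. *)
move=> /andP[eta0 eta1] e0; pose z := Num.max (1 - eta) (1 + eta)^-1.
have z0 : 0 <= z by rewrite le_max subr_ge0 eta1.
have z1 : z < 1.
  by rewrite gt_max; apply/andP; split; [lra|rewrite invf_lt1; lra].
have [|n zn] := expr_small z e _ e0; first by rewrite z0.
exists n; split=> y /andP[h1 h2].
  apply: (le_trans (step_poly_le n y _)); first by lra.
  apply: le_trans zn; apply: lerXn2r; rewrite ?nnegrE //; first by lra.
  by rewrite le_max; apply/orP; left; lra.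
apply: (@le_trans _ _ (1 - (2 * y) ^- n)); last by apply: step_poly_ge; lra.
rewrite lerD2l lerN2; apply: le_trans zn; rewrite -exprVn.
apply: lerXn2r; rewrite ?nnegrE ?invr_ge0 //; first by lra.
by rewrite le_max; apply/orP; right; rewrite lef_pV2 ?posrE; lra.
Qed.

End StepPolynomials.

(** * From moments to the distribution function *)

Section MethodOfMoments.
Variables (R : realType) (Om : nat -> finType).
Variable W : forall N, Om N -> R.
Hypothesis W_moments : forall d,
  uexp (fun w => W N w ^+ d) @[N --> \oo] --> gmom R d.

Let E N (f : R -> R) : R := uexp (fun w => f (W N w)).

Let ED N f g : E N (fun x => f x + g x) = E N f + E N g.
Proof. exact: (uexpD R (Om N)). Qed.

Let EZ N a f : E N (fun x => a * f x) = a * E N f.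
Proof. exact: (uexpZ R (Om N)). Qed.

Let E_le N f g : (forall x, f x <= g x) -> E N f <= E N g.
Proof.
by move=> fg; rewrite /E /uexp ler_wpM2r ?invr_ge0 //; apply: ler_sum => w _.
Qed.

Definition good (f : R -> R) : Prop := gint R f /\ E N f @[N --> \oo] --> gexp R f.

Lemma good_eq f g : f =1 g -> good f -> good g.
Proof. by move=> /funext ->. Qed.

Lemma goodD f g : good f -> good g -> good (fun x => f x + g x).
Proof.
move=> [jf cf] [jg cg]; split; first exact: gintD.
by rewrite gexpD //; under eq_fun do rewrite ED; exact: cvgD.
Qed.

Lemma goodZ a f : good f -> good (fun x => a * f x).
Proof.
move=> [jf cf]; split; first exact: gintZ.
by rewrite gexpZ //; under eq_fun do rewrite EZ; apply: cvgM => //; exact: cvg_cst.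
Qed.

Lemma good_expn d : good (fun x => x ^+ d).
Proof. by split; [exact: gint_expn|rewrite gexp_expn; exact: W_moments]. Qed.

Lemma gmom_even k : gmom R k.*2 / k.*2`!%:R = (2 ^+ k * k`!%:R)^-1.
Proof.
elim: k => [|k IH]; first by rewrite /gmom /= fact0 expr0 mulr1 divr1 invr1.
have f0 n : n`!%:R != 0 :> R by rewrite pnatr_eq0 -lt0n fact_gt0.
have s0 n : n.+1%:R != 0 :> R by rewrite pnatr_eq0.
rewrite doubleS gmomSS.
have -> : gmom R k.*2 = (2 ^+ k * k`!%:R)^-1 * k.*2`!%:R by rewrite -IH divfK.
rewrite !factS !natrM exprS.
have -> : k.*2.+2%:R = 2 * k.+1%:R :> R by rewrite -natrM mul2n -doubleS.
have e0 : 2 ^+ k != 0 :> R by rewrite expf_neq0.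
by field; rewrite !nat1r !s0 !f0 e0.
Qed.

(** By [gmom_even] these are the terms (s^2 / 2)^k / k! of an exponential series, which tend to 0
    for every s. This growth condition is what lets the moments determine the normal law. *)
Lemma gmom_small (s e : R) : 0 < e ->
  exists k, `|s| ^+ k.*2 / k.*2`!%:R * gmom R k.*2 <= e.
Proof.
move=> e0; have /cvgnP/(_ e e0)[k hk] := cvg_exp_coeff (s ^+ 2 / 2).
exists k; have := hk k (leqnn k); rewrite subr0 /exp_coeff /= => /(le_trans (ler_norm _)).
apply: le_trans; rewrite -[leLHS]mulrA [_^-1 * gmom _ _]mulrC gmom_even.
rewrite -mul2n exprM real_normK ?num_real // expr_div_n invfM -!mulrA.
by rewrite lexx.
Qed.

(* The moments control the error of the Taylor polynomials of the cosine, both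
   under the uniform laws and under the normal law. *)
Lemma good_cos s b : good (fun x => cos (s * x + b)).
Proof.
pose f x : R := cos (s * x + b).
have mf : measurable_fun [set: R] f.
  apply: measurableT_comp; first by apply: continuous_measurable_fun; exact: continuous_cos.
  by apply: measurable_funD => //; exact: measurable_funM.
have jf : gint R f by apply: (gint_bounded _ _ 1) => // x; exact: cos_max.
split=> //.
(* Each derivative of the cosine is a shift of the phase by pi / 2, which gives the bound |s|^k at
   once. *)
pose F k (x : R) := s ^+ k * cos (s * x + (b + k%:R * (pi / 2))).
have dF k : has_derivative R (F k) (F k.+1).
  have h := has_derivativeZ _ _ (s ^+ k) _ (has_derivative_comp _ _ _ _ _
    (fun x : R => is_derive_cos x) (has_derivativeD _ _ _ _ _
      (has_derivativeZ _ _ s _ (has_derivative_id R))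
      (has_derivative_cst R (b + k%:R * (pi / 2))))).
  move=> x; apply: (is_derive_eq (h x)).
  have e1 : s * x + (b + k.+1%:R * (pi / 2)) =
      (s * x + (b + k%:R * (pi / 2))) + pi / 2 by rewrite -natr1; ring.
  by rewrite /F exprS e1 cosDpihalf; ring.
have F0 x : F 0%N x = f x by rewrite /F expr0 mul1r mul0r addr0.
have bnd n x : `|f x - taylor R F n x| <= `|s| ^+ n * (`|x| ^+ n / n`!%:R).
  rewrite -F0; apply: taylor_bound => // y _.
  by rewrite normrM normrX ler_piMr ?exprn_ge0 // cos_max.
have goodT n : good (taylor R F n).
  elim: n => [|n [jn cn]].
    apply: (good_eq (fun x => 0 * x ^+ 0)); last exact/goodZ/good_expn.
    by move=> x; rewrite /taylor big_ord0 mul0r.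
  apply: (good_eq (fun x => taylor R F n x + (F n 0 / n`!%:R) * x ^+ n)).
    by move=> x; rewrite /taylor big_ord_recr /=; congr (_ + _); ring.
  by apply: goodD => //; exact/goodZ/good_expn.
apply/cvgnP => e e0.
(* Four errors add up: the normal mean of B twice, and the distances of the uniform means of B and
   of the Taylor polynomial from their limits. *)
have e4 : 0 < e / 4 by lra.
have [k hk] := gmom_small s _ e4.
(* The degree is even, so the error bound is itself a polynomial and its mean is governed by the
   moments. *)
pose B (x : R) := `|s| ^+ k.*2 / k.*2`!%:R * x ^+ k.*2.
have goodB : good B by exact/goodZ/good_expn.
have bndB x : `|f x - taylor R F k.*2 x| <= B x.
  apply: (le_trans (bnd _ x)); rewrite /B -mulrA [_ / _]mulrC.
  by rewrite -[X in `|x| ^+ X]mul2n exprM real_normK ?num_real // -exprM mul2n.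
have [jB cB] := goodB; have [jT cT] := goodT k.*2.
have gB : gexp R B <= e / 4 by rewrite /B gexpZ ?gexp_expn //; exact: gint_expn.
have /cvgnP/(_ _ e4)[N1 h1] := cB; have /cvgnP/(_ _ e4)[N2 h2] := cT.
exists (maxn N1 N2) => N; rewrite geq_max => /andP[/h1 k1 /h2 k2].
have jTB a : gint R (fun x => taylor R F k.*2 x + a * B x) by apply: gintD => //; exact: gintZ.
have u1 : gexp R f <= gexp R (taylor R F k.*2) + 1 * gexp R B.
  rewrite -gexpZ // -gexpD //; last exact: gintZ.
  by apply: gexp_le => // x; have := bndB x; rewrite ler_norml => /andP[_ ?]; lra.
have u2 : gexp R (taylor R F k.*2) + -1 * gexp R B <= gexp R f.
  rewrite -gexpZ // -gexpD //; last exact: gintZ.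
  by apply: gexp_le => // x; have := bndB x; rewrite ler_norml => /andP[? _]; lra.
have u3 : E N f <= E N (taylor R F k.*2) + 1 * E N B.
  rewrite -EZ -ED; apply: E_le => x.
  by have := bndB x; rewrite ler_norml => /andP[_ ?]; lra.
have u4 : E N (taylor R F k.*2) + -1 * E N B <= E N f.
  rewrite -EZ -ED; apply: E_le => x.
  by have := bndB x; rewrite ler_norml => /andP[? _]; lra.
move: k1 k2; rewrite !ler_norml => /andP[? ?] /andP[? ?].
by apply/andP; split; lra.
Qed.

(** Stability under multiplication by any cosine is the strengthening needed for induction over
    polynomials: a product of two cosines is a half-sum of cosines. *)
Let trig (f : R -> R) := forall s b, good (fun x => f x * cos (s * x + b)).

Let trig_good f : trig f -> good f.
Proof.
by move=> /(_ 0 0); apply: good_eq => x; rewrite mul0r addr0 cos0 mulr1.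
Qed.

Let trig_poly (p : {poly R}) s b :
  trig (fun x => p.[(1 + cos (s * x + b)) / 2]).
Proof.
elim/poly_ind: p => [|p c IH] s' b'.
  by apply: (good_eq (fun x => 0 * x ^+ 0)) (goodZ _ _ (good_expn 0)) => x;
    rewrite horner0 !mul0r.
pose f x := p.[(1 + cos (s * x + b)) / 2].
apply: (good_eq (fun x => (c * cos (s' * x + b') +
   2^-1 * (f x * cos (s' * x + b'))) +
   (4^-1 * (f x * cos ((s + s') * x + (b + b'))) +
    4^-1 * (f x * cos ((s - s') * x + (b - b')))))).
  move=> x; rewrite hornerMXaddC -/(f x).
  have -> : (s + s') * x + (b + b') = (s * x + b) + (s' * x + b') by ring.
  have -> : (s - s') * x + (b - b') = (s * x + b) - (s' * x + b') by ring.
  move: (f x) (s * x + b) (s' * x + b') => fx u v.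
  by rewrite cosD cosB; field.
by apply: goodD; apply: goodD; apply: goodZ; [exact: good_cos|exact: IH..].
Qed.

Let ind (t x : R) : R := (x <= t)%R%:R.

Let ind_itv t x : 0 <= ind t x <= 1.
Proof. by rewrite /ind; case: (x <= t); rewrite ?lexx ?ler01. Qed.

Let step_approx (t d e : R) : 0 < d -> 0 < e -> exists2 f, good f &
  (forall x, ind t x <= f x + e * (1 + x ^+ 2)) /\
  (forall x, f x <= ind (t + d) x + e * (1 + x ^+ 2)).
Proof.
move=> d0 e0.
(* The second summand makes e x^2 >= 1 when |x| >= K / 4; the first keeps the point c + 2 H, beyond
   which the next period begins, above K / 4. *)
pose K : R := 8 * (`|t| + d + 1) + 4 * (1 + e^-1).
have ie : 0 < e^-1 by rewrite invr_gt0.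
have tn : - `|t| <= t <= `|t| by rewrite -ler_norml.
have /andP[tn1 tn2] := tn.
have big x : K / 4 <= `|x| -> 1 <= e * x ^+ 2.
  move=> hx; have hx1 : 1 + e^-1 <= `|x| by rewrite (le_trans _ hx) // /K; lra.
  rewrite -(real_normK (num_real x)).
  have : (1 + e^-1) ^+ 2 <= `|x| ^+ 2 by apply: lerXn2r; rewrite ?nnegrE //; lra.
  have ee : e * e^-1 = 1 by rewrite mulfV // gt_eqF.
  by nra.
pose c : R := (t - K) / 2; pose H : R := (t + d + K) / 2.
have K0 : 8 * (`|t| + d + 1) <= K by rewrite /K; lra.
have H0 : 0 < H by rewrite /H; lra.
pose th : R := pi / 2 / H.
have pi0 := pi_gt0 R.
have th0 : 0 < th by apply: divr_gt0 => //; apply: divr_gt0.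
have thH : th * H = pi / 2 by rewrite /th divfK // gt_eqF.
(* At distance d / 2 inside or outside the edge of the window the cosine equals sin a or - sin a;
   this is the margin around 1/2 required of the step polynomial. *)
pose a := th * (d / 2).
have a0 : 0 < a by rewrite mulr_gt0 //; lra.
have aH : a < pi / 2 by rewrite /a -thH ltr_pM2l // /H; lra.
pose eta := sin a.
have eta0 : 0 < eta by apply: sin_gt0_pi; lra.
have eta1 : eta <= 1 by exact: sin_le1.
have [|n [n1 n2]] := step_poly_sep R eta e _ e0; first by rewrite eta0.
pose y (x : R) := (1 + cos (th * x + - (th * c))) / 2.
have yE x : y x = (1 + cos (th * `|x - c|)) / 2.
  rewrite /y; congr ((1 + _) / 2); rewrite -[RHS]cos_norm normrM normr_id.
  by rewrite -normrM cos_norm; congr cos; ring.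
have y01 x : 0 <= y x <= 1.
  by have := cos_le1 (th * x + - (th * c)); have := cos_geN1 (th * x + - (th * c)); rewrite /y; lra.
have cosle (u v : R) : 0 <= u -> u <= v -> v <= pi -> cos v <= cos u.
  move=> u0; rewrite le_eqVlt => /orP[/eqP->//|uv] vp; apply: ltW.
  by rewrite ltr_cos // in_itv /=; apply/andP; split; lra.
have near_c x : `|x - c| <= H - d / 2 -> (1 + eta) / 2 <= y x <= 1.
  move=> hx; have /andP[_ ->] := y01 x; rewrite andbT yE.
  suff : eta <= cos (th * `|x - c|) by lra.
  have <- : cos (pi / 2 - a) = eta by rewrite -cosN opprB cosBpihalf.
  apply: cosle; first by rewrite mulr_ge0 // ltW.
    by rewrite -thH /a -mulrBr ler_pM2l.
  by lra.
have far_c x : H + d / 2 <= `|x - c| <= 2 * H -> 0 <= y x <= (1 - eta) / 2.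
  move=> /andP[h1 h2]; have /andP[-> _] := y01 x; rewrite yE /=.
  suff : cos (th * `|x - c|) <= - eta by lra.
  have <- : cos (a + pi / 2) = - eta by rewrite cosDpihalf.
  have le1 : a + pi / 2 <= th * `|x - c| by rewrite -thH /a -mulrDr ler_pM2l // addrC.
  have le2 : th * `|x - c| <= pi.
    have -> : pi = th * (2 * H) by rewrite mulrCA thH; field.
    by rewrite ler_pM2l.
  by apply: cosle => //; lra.
exists (fun x => (step_poly R n).[y x]); first exact/trig_good/trig_poly.
have fitv x := step_poly_itv R n (y x) (y01 x).
split=> x; have /andP[f0 f1] := fitv x; have x20 := sqr_ge0 x.
  have ex0 : 0 <= e * x ^+ 2 by rewrite mulr_ge0 // ltW.
  have /andP[i0 i1] := ind_itv t x.
  have [xt|xt] := leP x t; last first.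
    have -> : ind t x = 0 by rewrite /ind leNgt xt.
    by rewrite addr_ge0 // mulr_ge0 ?addr_ge0 // ltW.
  have [xK|xK] := leP (- K) x.
    have hx : `|x - c| <= H - d / 2.
      by rewrite ler_norml /c /H; apply/andP; split; lra.
    by have := n2 _ (near_c x hx); lra.
  have hx : K / 4 <= `|x| by rewrite ltr0_norm; lra.
  by have := big x hx; lra.
have ex0 : 0 <= e * x ^+ 2 by rewrite mulr_ge0 // ltW.
have [xt|xt] := leP x (t + d).
  have -> : ind (t + d) x = 1 by rewrite /ind xt.
  by rewrite (le_trans f1) // lerDl mulr_ge0 ?addr_ge0 // ltW.
have /andP[i0 i1] := ind_itv (t + d) x.
have xc0 : 0 <= x - c by rewrite /c; lra.
have [xH|xH] := leP (x - c) (2 * H).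
  have hx : H + d / 2 <= `|x - c| <= 2 * H.
    by rewrite ger0_norm // xH andbT /c /H; lra.
  by have := n1 _ (far_c x hx); lra.
have hx : K / 4 <= `|x|.
  by move: xH; rewrite /c /H => xH; rewrite (le_trans _ (ler_norm x)) //; lra.
by have := big x hx; lra.
Qed.

Let ind_indic t : ind t = \1_(`]-oo, t]%classic : set R).
Proof. by apply/funext => x; rewrite indicE mem_setE in_itv. Qed.

Let gint_ind t : gint R (ind t).
Proof.
apply: (gint_bounded _ _ 1) => [|x].
  by rewrite ind_indic; exact: measurable_indic.
by have /andP[i0 i1] := ind_itv t x; rewrite ger0_norm.
Qed.

Let Phi t : R := gexp R (ind t).

Let PhiE t : normal_prob (0 : R) (1 : R) [set x : R | x <= t] = (Phi t)%:E.
Proof.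
have [_ ji] := gint_ind t.
rewrite /Phi /gexp /Rintegral fineK; last exact: integrable_fin_num.
rewrite /normal_prob [LHS]integral_mkcond; apply: eq_integral => x _.
rewrite patchE /ind; have [xt|xt] := boolP (x <= t).
  by rewrite ifT ?mul1r // inE.
by rewrite ifF ?mul0r //; apply/negbTE; rewrite notin_setE /=; exact/negP.
Qed.

(** The normal density is bounded by its peak, so shifting the half-line by d costs at most the area
    of a rectangle of width d. *)
Let Phi_lipschitz t d : 0 < d -> Phi (t + d) <= Phi t + normal_peak (1 : R) * d.
Proof.
move=> d0; have [_ j1] := gint_ind t; have [_ j2] := gint_ind (t + d).
pose A := (`]t, (t + d)%R]%classic : set R).
have mA : measurable A by exact: measurable_itv.
have jA : (@lebesgue_measure R).-integrable [set: R] (EFin \o \1_A).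
  exact: integrable_indic_itv.
have jpA : (@lebesgue_measure R).-integrable [set: R]
    (EFin \o (fun x => normal_peak (1 : R) * \1_A x)).
  have := integrableZl measurableT (normal_peak (1 : R)) jA.
  by apply: eq_integrable => // x _ /=; rewrite -EFinM.
have <- : \int[@lebesgue_measure R]_x (normal_peak (1 : R) * \1_A x) = normal_peak (1 : R) * d.
  rewrite RintegralZl //; congr (_ * _).
  transitivity (fine (@lebesgue_measure R A)).
    by rewrite /Rintegral integral_indic // setIT.
  by rewrite /A lebesgue_measure_itv /= lte_fin ltrDl d0 -EFinB /=; ring.
rewrite /Phi /gexp -RintegralD //; apply: le_Rintegral => //.
  have := integrableD measurableT j1 jpA.
  by apply: eq_integrable => // x _ /=; rewrite -EFinD.
move=> x _; have p0 := normal_pdf_ge0 (0 : R) (1 : R) x.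
have pp := normal_pdf_ub (0 : R) x (oner_neq0 R).
rewrite /ind indicE mem_setE in_itv /=.
case: (leP x t) => xt /=; last by rewrite mul0r add0r; case: (x <= t + d) => /=; lra.
have -> : x <= t + d by lra.
by rewrite mulr0 addr0.
Qed.

(** f1 lies between the indicators for t and t + d, f2 between those for t - d and t, up to
    [eps * q]. The choice of d keeps the shift within e / 4, and the other errors add up to 6
    [eps]. *)
Lemma method_of_moments t : (ucdf (W N) t)%:E @[N --> \oo]
  --> normal_prob (0 : R) (1 : R) [set x : R | x <= t].
Proof.
have ucdfE N : ucdf (W N) t = E N (ind t).
  rewrite /ucdf /E /uexp; congr (_ / _); rewrite -sum1_card natr_sum big_mkcond /=.
  by apply: eq_bigr => w _; rewrite /ind inE; case: (W N w <= t).
rewrite PhiE; apply: cvg_EFin; first exact: nearW.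
apply/cvgnP => e e0 /=.
pose p : R := normal_peak 1; have p0 : 0 <= p by exact: normal_peak_ge0.
pose d : R := e / (4 * (p + 1)).
have d0 : 0 < d by rewrite divr_gt0 // mulr_gt0 //; lra.
have pd : p * d <= e / 4.
  have <- : (p + 1) * d = e / 4 by rewrite /d; field; lra.
  by rewrite ler_wpM2r //; lra.
pose eps : R := e / 16; have eps0 : 0 < eps by rewrite /eps; lra.
have [f1 [j1 c1] [u1 v1]] := step_approx t d eps d0 eps0.
have [f2 [j2 c2] [u2 v2]] := step_approx (t - d) d eps d0 eps0.
rewrite subrK in v2.
pose q (x : R) := 1 + x ^+ 2.
have [jq cq] : good q.
  apply: goodD; last exact: good_expn.
  exact: (good_eq (fun x => x ^+ 0) _ (fun x => expr0 x) (good_expn 0)).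
have q2 : gexp R q = 2.
  rewrite /q gexpD ?gexp_cst ?gexp_expn; [|exact: gint_cst|exact: gint_expn].
  by rewrite /gmom /=; ring.
rewrite q2 in cq.
have /cvgnP/(_ _ eps0)[N1 h1] := c1; have /cvgnP/(_ _ eps0)[N2 h2] := c2.
have /cvgnP/(_ _ ltr01)[N3 h3] := cq.
exists (maxn N1 (maxn N2 N3)) => N; rewrite !geq_max => /and3P[/h1 k1 /h2 k2 /h3 k3].
have jB a : gint R (fun x => a * q x) by exact: gintZ.
have a1 : E N (ind t) <= E N f1 + eps * E N q.
  by rewrite -EZ -ED; apply: E_le => x; exact: u1.
have a2 : gexp R f1 <= Phi (t + d) + eps * 2.
  rewrite -q2 -gexpZ // -gexpD //; apply: gexp_le => //; first exact: gintD.
have a3 : E N f2 <= E N (ind t) + eps * E N q.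
  by rewrite -EZ -ED; apply: E_le => x; exact: v2.
have a4 : Phi (t - d) <= gexp R f2 + eps * 2.
  by rewrite -q2 -gexpZ // -gexpD //; apply: gexp_le => //; exact: gintD.
have b1 := Phi_lipschitz t d d0; have b2 := Phi_lipschitz (t - d) d d0.
rewrite subrK in b2.
rewrite ucdfE; move: k1 k2 k3; rewrite !ler_norml => /andP[? ?] /andP[? ?] /andP[k3 k4].
have e3 : eps * E N q <= eps * 3 by rewrite ler_pM2l //; lra.
rewrite -/p in b1 b2.
have epsE : eps = e / 16 by [].
by clearbody eps; apply/andP; split; lra.
Qed.

End MethodOfMoments.

(** * Asymptotics of the rank *)

Section CumulantsToMoments.
Variable R : realType.

(** If only the second cumulant survives in the limit, the sum keeps the single term i = 1, and that
    is the Gaussian recursion. *)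
Lemma cvg_moments (kap mom : nat -> nat -> R) :
  (forall N, mom N 0%N = 1) ->
  (forall N n, mom N n.+1 =
     \sum_(i < n.+1) 'C(n, i)%:R * kap N i.+1 * mom N (n - i)%N) ->
  (forall d, (0 < d)%N -> kap N d @[N --> \oo] --> ((d == 2%N)%:R : R)) ->
  forall d, mom N d @[N --> \oo] --> gmom R d.
Proof.
move=> mom0 momS hkap; elim/ltn_ind => -[|n] IH.
  by under eq_fun do rewrite mom0; exact: cvg_cst.
have -> : gmom R n.+1 =
    \sum_(i < n.+1) 'C(n, i)%:R * (i.+1 == 2%N)%:R * gmom R (n - i).
  case: n {IH} => [|n]; first by rewrite big_ord1 /= mulr0 mul0r.
  rewrite gmomSS big_ord_recl big_ord_recl big1 => [|i _]; last by rewrite mulr0 mul0r.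
  by rewrite /= /bump /= mulr0 mul0r add0r addr0 bin1 mulr1 subSS subn0.
under eq_fun do rewrite momS.
apply: (cvgn_sum R n.+1 (fun i N => 'C(n, i)%:R * kap N i.+1 * mom N (n - i)%N)
  (fun i => 'C(n, i)%:R * (i.+1 == 2%N)%:R * gmom R (n - i))) => i hi.
apply: cvgM; last by apply: IH; rewrite ltnS leq_subr.
by apply: cvgM; [exact: cvg_cst|exact: hkap].
Qed.

End CumulantsToMoments.

(** Used with p the numerator and z the denominator of [weft], so that all but the power of p / z is
    a constant. *)
Lemma invX_mulX (F : fieldType) (a p z b : F) k : a != 0 -> p != 0 -> z != 0 ->
  (a * p)^-1 ^+ k.+1 * (b * (p * z ^+ k)) = b / a ^+ k.+1 / (p / z) ^+ k.
Proof.
move=> a0 p0 z0; rewrite !exprMn !exprVn exprMn !invfM invrK exprSr [p ^+ k.+1]exprS.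
have [ak pk] : a ^+ k != 0 /\ p ^+ k != 0 by rewrite !expf_neq0.
by field; rewrite a0 ak p0 pk.
Qed.

Section RankAsymptotics.
Variable R : realType.

(** For d >= 2 this is |B_d| / d, with B_d the Bernoulli number. *)
Definition cumulant_coef d : R := `|qint_cumulant R d 2 / (2 ^+ d - 1)|.

Lemma cumulant_coef_gt0 d : (2 <= d)%N -> ~~ odd d -> 0 < cumulant_coef d.
Proof.
move=> d2 ed; rewrite normr_gt0 mulf_neq0 ?qint_cumulant2_even // invr_neq0 // subr_eq0.
by rewrite gt_eqF // exprn_egt1 ?ltr1n // -lt0n ltnW.
Qed.

Variables (lam : seq nat) (m : nat) (l e : seq nat).
Hypothesis lamP : is_partition lam.
Hypothesis lam_le : (size lam <= m)%N.
Hypothesis lam_exp : exp_notation lam m l e.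

Let X := rank_var R lam m.
Let ps d := pair_sum R l e d.

Lemma hook_sum_ge0 d : 0 <= hook_sum R lam m d.+1.
Proof.
have /andP[h _] := hook_sum_bounds R lam m l e lam_exp d; apply: le_trans h.
by rewrite divr_ge0 ?exprn_ge0 //; exact: (pair_sum_ge0 R lam m).
Qed.

Lemma cumulant_bounds d : (2 <= d)%N ->
  cumulant_coef d / 2 ^+ d * ps d.-1 <= `|ucumulant d X| <= cumulant_coef d * d%:R * ps d.-1.
Proof.
case: d => [|d] // d2; rewrite /X ucumulant_rank // 2!normrM normrX normrN1 expr1n mul1r.
rewrite -/(cumulant_coef d.+1) [`|hook_sum _ _ _ _|]ger0_norm ?hook_sum_ge0 //.
have /andP[h1 h2] := hook_sum_bounds R lam m l e lam_exp d.
have b0 : 0 <= cumulant_coef d.+1 by exact: normr_ge0.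
apply/andP; split.
  by rewrite -mulrA [_^-1 * _]mulrC; apply: ler_wpM2l.
by rewrite -mulrA; apply: ler_wpM2l.
Qed.

Let n0 := ssyt_gt0 R lam m lamP lam_le.

Lemma ustd_affine : ustd X =
  fun w => (Num.sqrt (uvar X))^-1 * X w + - (uexp X / Num.sqrt (uvar X)).
Proof. by apply/funext => w; rewrite /ustd mulrBl mulrC. Qed.

Lemma ucumulant_ustd1 : ucumulant 1 (ustd X) = 0.
Proof.
rewrite ucumulant1 // ustd_affine uexpD uexpZ uexp_cst // mulrC; exact: subrr.
Qed.

Lemma ucumulant_ustd d : (2 <= d)%N ->
  ucumulant d (ustd X) = (Num.sqrt (uvar X))^-1 ^+ d * ucumulant d X.
Proof. by move=> d2; rewrite ustd_affine ucumulant_affine. Qed.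

Lemma ucumulant_ustd_odd d : (2 <= d)%N -> odd d -> ucumulant d (ustd X) = 0.
Proof.
move=> d2 od; rewrite ucumulant_ustd // /X ucumulant_rank // qint_cumulant2_odd //.
by rewrite mul0r mulr0 mul0r mulr0.
Qed.

Hypothesis weft_gt0 : 0 < weft R l e m.

Let M : R := Defs.diff R l 0 (size l).-1 - 1 + m%:R.

Let M2_gt0 : 0 < M ^+ 2.
Proof.
rewrite lt_neqAle sqr_ge0 andbT eq_sym; apply: contraTneq weft_gt0.
by rewrite /weft -/M => ->; rewrite invr0 mulr0 ltxx.
Qed.

Let ps1_gt0 : 0 < ps 1.
Proof. by move: weft_gt0; rewrite /weft -/M pmulr_lgt0 // invr_gt0. Qed.

Let uvar_ge : cumulant_coef 2 / 2 ^+ 2 * ps 1 <= uvar X.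
Proof.
have /andP[h _] := cumulant_bounds 2 isT; apply: le_trans h _.
rewrite ucumulant2 // ger0_norm // /uvar /uexp mulr_ge0 ?invr_ge0 //.
by apply: sumr_ge0 => w _; exact: sqr_ge0.
Qed.

Let a2_gt0 : 0 < cumulant_coef 2 / 2 ^+ 2.
Proof. by rewrite divr_gt0 ?cumulant_coef_gt0 ?exprn_gt0. Qed.

Let uvar_gt0 : 0 < uvar X.
Proof. by apply: lt_le_trans uvar_ge; rewrite mulr_gt0. Qed.

Let sqrt_uvar k : (Num.sqrt (uvar X))^-1 ^+ k.*2 = (uvar X)^-1 ^+ k.
Proof. by rewrite -mul2n exprM exprVn sqr_sqrtr // ltW. Qed.

Lemma ucumulant_ustd2 : ucumulant 2 (ustd X) = 1.
Proof.
rewrite ucumulant_ustd // ucumulant2 // (sqrt_uvar 1) expr1 mulVf //.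
by rewrite gt_eqF.
Qed.

(** The cumulant of order 2 k + 2 is O([ps 1] M^(2k)) and the variance is at least a constant times
    [ps 1]; dividing by the (k+1)-st power of the variance leaves (M^2 / [ps 1])^k. *)
Lemma ucumulant_ustd_le k : `|ucumulant k.*2.+2 (ustd X)| <=
  cumulant_coef k.*2.+2 * k.*2.+2%:R / (cumulant_coef 2 / 2 ^+ 2) ^+ k.+1 / weft R l e m ^+ k.
Proof.
rewrite ucumulant_ustd // normrM -doubleS sqrt_uvar ger0_norm; last first.
  by rewrite exprn_ge0 // invr_ge0 ltW.
have /andP[_ h] := cumulant_bounds k.+1.*2 isT.
have hM := pair_sum_le R lam m l e lam_exp k.*2.
have b0 : 0 <= cumulant_coef k.+1.*2 * k.+1.*2%:R by rewrite mulr_ge0 // normr_ge0.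
have u0 : 0 <= (uvar X)^-1 ^+ k.+1 by rewrite exprn_ge0 // invr_ge0 ltW.
apply: (@le_trans _ _ ((cumulant_coef 2 / 2 ^+ 2 * ps 1)^-1 ^+ k.+1 *
   (cumulant_coef k.+1.*2 * k.+1.*2%:R * (ps 1 * M ^+ k.*2)))).
  apply: ler_pM => //.
    apply: lerXn2r; rewrite ?nnegrE ?invr_ge0 ?(ltW uvar_gt0) //.
      by rewrite mulr_ge0 // ltW.
    by rewrite lef_pV2 ?posrE // mulr_gt0.
  by apply: le_trans h _; rewrite doubleS; exact: ler_wpM2l.
have p0 : ps 1 != 0 by rewrite gt_eqF.
have m0 : M != 0 by move: M2_gt0; apply: contraTneq => ->; rewrite expr0n ltxx.
have -> : M ^+ k.*2 = (M ^+ 2) ^+ k by rewrite -exprM mul2n.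
by rewrite invX_mulX // ?expf_neq0 // gt_eqF.
Qed.

End RankAsymptotics.

Theorem theorem4p10 (R : realType)
    (lam : nat -> seq nat) (m : nat -> nat) (l e : nat -> seq nat)
    (lam_partition : forall N : nat, is_partition (lam N))
    (lam_length : forall N : nat, (size (lam N) <= m N)%N)
    (lam_exp : forall N : nat, exp_notation (lam N) (m N) (l N) (e N)) :
  (forall d : nat, (2 <= d)%N -> ~~ odd d ->
     Theta (fun N : nat => `|ucumulant d (rank_var R (lam N) (m N))|)
           (fun N : nat => pair_sum R (l N) (e N) d.-1))
  /\
  ((weft R (l N) (e N) (m N) @[N --> \oo] --> +oo) ->
     asymp_normal (fun N : nat => rank_var R (lam N) (m N))).
Proof.
split=> [d d2 ed|weft_oo].
  exists (cumulant_coef R d / 2 ^+ d), (cumulant_coef R d * d%:R); split.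
  - by rewrite divr_gt0 ?cumulant_coef_gt0 ?exprn_gt0.
  - by rewrite mulr_gt0 ?cumulant_coef_gt0 // ltr0n ltnW.
  - apply: nearW => N; exact: (cumulant_bounds R _ _ _ _ (lam_partition N) (lam_length N)).
have Om0 N := ssyt_gt0 R _ _ (lam_partition N) (lam_length N).
pose kap N d := ucumulant d (ustd (rank_var R (lam N) (m N))).
have weft_ge (A : R) : exists N0, forall N, (N0 <= N)%N -> A <= weft R (l N) (e N) (m N).
  by move/cvgryPge: weft_oo => /(_ A)[N0 _ hN]; exists N0 => N /hN.
move=> t; apply: (method_of_moments R (fun N => ssyt (lam N) (m N))
  (fun N => ustd (rank_var R (lam N) (m N)))).
apply: (cvg_moments R kap (fun N d => uexp (fun w => ustd (rank_var R (lam N) (m N)) w ^+ d))).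
- by move=> N; apply: uexp_cst; exact: Om0.
- by move=> N n; exact: moment_cumulant.
case=> [//|[|[|d]]] _; rewrite /kap.
- under eq_fun do rewrite ucumulant_ustd1 //; exact: cvg_cst.
(* The standardized variance is 1 only if the variance is nonzero, which holds once [weft] is
   positive. *)
- apply/cvgnP => eps eps0; have [N0 hN] := weft_ge 1; exists N0 => N /hN w1.
  rewrite (ucumulant_ustd2 R _ _ (l N) (e N)) // ?subrr ?normr0 ?ltW //.
  exact: lt_le_trans ltr01 w1.
have [od|ed] := boolP (odd d.+3).
  under eq_fun do rewrite ucumulant_ustd_odd //; exact: cvg_cst.
have [k dk] : exists k, d.+3 = k.+1.*2.+2.
  by exists (d.+3./2.-2); have := odd_double_half d.+3; rewrite (negbTE ed); lia.
rewrite dk; apply/cvgnP => eps eps0.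
pose C : R := cumulant_coef R k.+1.*2.+2 * k.+1.*2.+2%:R / (cumulant_coef R 2 / 2 ^+ 2) ^+ k.+2.
have C0 : 0 <= C.
  have b0 i : 0 <= cumulant_coef R i by exact: normr_ge0.
  by apply: divr_ge0; [exact: mulr_ge0|apply: exprn_ge0; exact: divr_ge0].
(* The summand 1 gives weft^(k+1) >= weft, so the first power already beats C / eps. *)
have [N0 hN] := weft_ge (1 + C / eps); exists N0 => N /hN w.
have Ce : 0 <= C / eps by rewrite divr_ge0 // ltW.
have w1 : 1 <= weft R (l N) (e N) (m N) by lra.
have w0 : 0 < weft R (l N) (e N) (m N) by lra.
rewrite subr0; apply: (le_trans (ucumulant_ustd_le R _ _ _ _ (lam_partition N)
  (lam_length N) (lam_exp N) w0 k.+1)); rewrite -/C.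
rewrite ler_pdivrMr ?exprn_gt0 // -ler_pdivrMl // [_^-1 * _]mulrC.
apply: (@le_trans _ _ (weft R (l N) (e N) (m N))); first by lra.
by rewrite exprS ler_peMr ?exprn_ege1 // ltW.
Qed.
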